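(* Consider hollow heaps of any of the three kinds described in the context (multi-root, one-root, or two-parent), augmented with rebuilding as described in the context for a fixed constant $c>1$. Then, for any sequence of operations starting with no heaps, the amortized time per operation is $O(1)$ for each operation other than delete-min and delete, and $O(\log n)$ for each delete-min or delete on a heap of $n$ items; moreover the space used by each heap is $O(n)$, where $n$ is its number of items.
   Context: Heaps. A heap stores a finite set of items, each with a key from a totally ordered universe, and supports: make-heap(), find-min($h$), insert($e,k,h$), delete-min($h$), meld($h_1,h_2$) (of item-disjoint heaps), decrease-key($e,k,h$) (given $e$ in $h$ with key greater than $k$, change its key to $k$), delete($e,h$), with the usual meanings; heaps passed as arguments are destroyed; decrease-key and delete are given the location of $e$. Nodes. Nodes hold items: each node holds at most one item, and is full if it holds one and hollow otherwise; each item in a heap is held by exactly one node; a newly created node is full and a hollow node never becomes full again. Each node $u$ has a key $u.key$ (the current key of its item if full, else the key its item had just before leaving $u$) and a non-negative integer rank. Heap-ordered means $v.key\le w.key$ for every parent-child arc $(v,w)$; a root is a node with no parent. A link of two full roots makes the one of larger key (ties arbitrary) a child (loser) of the other (winner); a ranked link is between roots of equal rank and increases the winner's rank by one; an unranked link is between any two full roots and changes no ranks. Common operations. insert creates a new full node of rank 0 and melds it in; delete($e,h$) makes the node holding $e$ hollow, and if that node was the minimum node (the root, in the one-root and two-parent kinds), repeatedly destroys hollow roots (children left without parents become roots), then does ranked links while two roots have equal rank, then (except in the multi-root kind, where the minimum root is recorded) unranked links until one root remains; delete-min deletes the item in the minimum node. decrease-key($e,k,h$) with $u$ the node holding $e$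 (unless $u$ is a root, in which case one may just change its key) creates a new node $v$ holding $e$ with key $k$ and rank $\max\{0,u.rank-2\}$, makes $u$ hollow, and melds $v$ in, where: - Multi-root hollow heap: a set of heap-ordered trees with a pointer to a minimum-key full root; meld unites the tree sets; decrease-key moves to $v$ each child of $u$ of rank less than $v.rank$. - One-root hollow heap: a single heap-ordered tree with full root; meld is an unranked link of the roots; children are ranked/unranked according to the link they lost; decrease-key moves to $v$ each ranked child of $u$ of rank less than $v.rank$ and any subset of unranked children. - Two-parent hollow heap: a heap-ordered dag with a single, full root; meld is an unranked link of the roots; decrease-key moves no children but adds the arc $(v,u)$, giving $u$ a second parent. Rebuilding. For each heap, track $N$ (number of nodes, full and hollow) and $n$ (number of items). Whenever $N>cn$, rebuild the heap so that it contains no hollow nodes, in time $O(N)$, by either of: (1) destroy every hollow node, make each full node into a one-node heap of rank 0, and meld these heaps until one heap remains; or (2) in the two-parent case first remove one parent of every node having two, then give every full node rank 0, make each full non-root node a child of its nearest full proper ancestor (its child status becoming unranked), and destroy all hollow nodes. *)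

(* Defs.v *)
From HB Require Import structures.
From mathcomp Require Import all_boot all_order all_algebra.
From mathcomp Require Import finmap reals.

Set Implicit Arguments.
Unset Strict Implicit.
Unset Printing Implicit Defensive.

Local Open Scope fset_scope.
Local Open Scope fmap_scope.

(* The operations are given by a nondeterministic cost semantics. One unit of
   time is one creation, destruction, link, cut or visit of a node or arc;
   every freedom left to the implementation (ties, order of links, choice of
   moved unranked children, rebuilding method) is a nondeterministic choice.
   Node locations and heap names are natural numbers. *)

Inductive heap_kind := MultiRoot | OneRoot | TwoParent.

Section Heaps.
Context {disp : Order.disp_t} {Key : orderType disp} {Item : Type}.
Variable kind : heap_kind.

(* [nd_item] is [None] for a hollow node. [nd_ranked] is the status of the node
   as a child: whether the last link it lost was ranked. It is meaningless for
   a node that has not been a child since its creation or the last rebuild. *)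
Record node := Node {
  nd_item : option Item;
  nd_key : Key;
  nd_rank : nat;
  nd_ranked : bool }.

Definition hollow_out (v : node) := Node None (nd_key v) (nd_rank v) (nd_ranked v).
Definition with_key (k : Key) (v : node) :=
  Node (nd_item v) k (nd_rank v) (nd_ranked v).
Definition with_ranked (b : bool) (v : node) :=
  Node (nd_item v) (nd_key v) (nd_rank v) b.
Definition incr_rank (v : node) :=
  Node (nd_item v) (nd_key v) (nd_rank v).+1 (nd_ranked v).
Definition reset_rank (v : node) := Node (nd_item v) (nd_key v) 0 false.

(* [arcs] contains the pairs (parent, child). [minp] is the access pointer: the
   recorded minimum node of a multi-root heap, the root of the other kinds,
   [None] for the empty heap. *)
Record heap := Heap {
  nodes : {fmap nat -> node};
  arcs : {fset nat * nat};
  minp : option nat }.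

Definition empty_heap := Heap [fmap] fset0 None.

Definition one_node (x : nat) (e : Item) (k : Key) :=
  Heap [fmap].[x <- Node (Some e) k 0 false] fset0 (Some x).

Implicit Types (h : heap) (u v w x : nat).

Definition item h u : option Item := obind nd_item (nodes h).[? u].
Definition rank h u : nat := oapp nd_rank 0 (nodes h).[? u].
Definition ranked h u : bool := oapp nd_ranked false (nodes h).[? u].
Definition full h u : bool := isSome (item h u).
Definition hollow h u : bool := (u \in domf (nodes h)) && ~~ full h u.

Definition key_le h u v : bool :=
  if ((nodes h).[? u], (nodes h).[? v]) is (Some a, Some b)
  then (nd_key a <= nd_key b)%O else false.

Definition full_nodes h : {fset nat} := [fset u in domf (nodes h) | full h u].
Definition children h u : {fset nat} := [fset a.2 | a in arcs h & a.1 == u].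
Definition parents h u : {fset nat} := [fset a.1 | a in arcs h & a.2 == u].
Definition root_nodes h : {fset nat} :=
  [fset u in domf (nodes h) | parents h u == fset0].

(* N and n of the rebuilding rule. *)
Definition num_nodes h : nat := #|` domf (nodes h)|.
Definition num_items h : nat := #|` full_nodes h|.

Definition heap_space h : nat := (num_nodes h + #|` arcs h|)%N.

Definition find_min h : option Item := obind (item h) (minp h).

Definition set_minp (m : option nat) h := Heap (nodes h) (arcs h) m.

Definition update (u : nat) (f : node -> node) h :=
  if (nodes h).[? u] is Some v
  then Heap (nodes h).[u <- f v] (arcs h) (minp h) else h.

Definition is_min_root h m : Prop :=
  [/\ m \in root_nodes h, full h m &
      forall u, u \in root_nodes h -> full h u -> key_le h m u].

Inductive record_min h : heap -> Prop :=
| record_min_empty : root_nodes h = fset0 -> record_min h (set_minp None h)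
| record_min_root m : is_min_root h m -> record_min h (set_minp (Some m) h).

Definition link_arc (is_ranked : bool) (winner loser : nat) h :=
  let h' := update loser (with_ranked is_ranked) h in
  Heap (nodes h') ((winner, loser) |` arcs h') (minp h').

Definition linkable h winner loser : bool :=
  [&& winner \in root_nodes h, loser \in root_nodes h, winner != loser,
      full h winner, full h loser & key_le h winner loser].

(* Steps of the phases of a deletion: [step h t h'] leads from [h] to [h'] in
   time [t]. *)
Inductive destroy_step h : nat -> heap -> Prop :=
| destroy_root u : u \in root_nodes h -> hollow h u ->
    destroy_step h (1 + #|` children h u|)%N
      (Heap (nodes h).[~ u] [fset a in arcs h | a.1 != u] (minp h)).

Inductive ranked_link_step h : nat -> heap -> Prop :=
| ranked_link u v : linkable h u v -> rank h u = rank h v ->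
    ranked_link_step h 1 (update u incr_rank (link_arc true u v h)).

Inductive unranked_link_step h : nat -> heap -> Prop :=
| unranked_link u v : linkable h u v ->
    unranked_link_step h 1 (link_arc false u v h).

Inductive star (step : heap -> nat -> heap -> Prop) : heap -> nat -> heap -> Prop :=
| star_refl h : star step h 0 h
| star_step h t h1 t' h2 :
    step h t h1 -> star step h1 t' h2 -> star step h (t + t')%N h2.

(* Perform steps until none is possible. *)
Definition exhaust (step : heap -> nat -> heap -> Prop) h (t : nat) h' : Prop :=
  star step h t h' /\ forall t' h'', ~ step h' t' h''.

(* The linking that reduces the heap to one root, void for multi-root heaps. *)
Definition unify h (t : nat) h' : Prop :=
  if kind is MultiRoot then t = 0 /\ h' = h
  else exhaust unranked_link_step h t h'.

(* Last step of a meld, once the two node sets are in one graph: [a] and [b] are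
   the access pointers of the two parts. *)
Definition joined h winner loser : heap :=
  set_minp (Some winner)
    (if kind is MultiRoot then h else link_arc false winner loser h).

Inductive join h a b : heap -> Prop :=
| join_l : key_le h a b -> join h a b (joined h a b)
| join_r : key_le h b a -> join h a b (joined h b a).

Inductive meld : heap -> heap -> heap -> Prop :=
| meld_emptyl h1 h2 : minp h1 = None -> meld h1 h2 h2
| meld_emptyr h1 h2 : minp h2 = None -> meld h1 h2 h1
| meld_join h1 h2 a b h' : minp h1 = Some a -> minp h2 = Some b ->
    join (Heap (nodes h1 + nodes h2) (arcs h1 `|` arcs h2) None) a b h' ->
    meld h1 h2 h'.

(* [M] is a legal set of children of [u] to move to the new node [v] made by a
   decrease-key; [rank h u - 2] is the rank of [v] (truncated subtraction). *)
Definition movable h u (M : {fset nat}) : Prop :=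
  M `<=` children h u /\
  forall w, w \in children h u ->
    match kind with
    | MultiRoot => (w \in M) = (rank h w < rank h u - 2)%N
    | OneRoot => ranked h w -> (w \in M) = (rank h w < rank h u - 2)%N
    | TwoParent => w \notin M
    end.

Definition split_node h u x (k : Key) (M : {fset nat}) : heap :=
  let h' := update u hollow_out h in
  Heap (nodes h').[x <- Node (item h u) k (rank h u - 2) false]
    ([fset (if (a.1 == u) && (a.2 \in M) then (x, a.2) else a) | a in arcs h]
       `|` (if kind is TwoParent then [fset (x, u)] else fset0))
    (minp h).

(* With the children listed by decreasing rank, unranked ones last, the list is
   handed over to the new node in constant time and the children that stay are
   cut out of it, one unit each. In a two-parent heap no child is touched. *)
Definition split_time h u (M : {fset nat}) : nat :=
  if kind is TwoParent then 1 else (1 + #|` children h u `\` M|)%N.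

(* Only in a multi-root heap can a root be made hollow by a decrease-key: the
   meld of the new node with a one-root or two-parent heap links two full
   roots. *)
Inductive decrease_key h u x (k : Key) : nat -> heap -> Prop :=
| decrease_root m h' : u \in root_nodes h -> minp h = Some m ->
    let h1 := update u (with_key k) h in
    (key_le h1 u m /\ h' = set_minp (Some u) h1) \/
    (key_le h1 m u /\ h' = set_minp (Some m) h1) ->
    decrease_key h u x k 1 h'
| decrease_split m M h' : u \notin root_nodes h \/ kind = MultiRoot ->
    minp h = Some m -> movable h u M ->
    join (split_node h u x k M) x m h' ->
    decrease_key h u x k (split_time h u M + 1)%N h'.

(* The deletion of the minimum visits all roots once they are full, and scans an
   array of roots indexed by rank after the ranked links. *)
Inductive delete_node h u : nat -> heap -> Prop :=
| delete_other : minp h <> Some u ->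
    delete_node h u 1 (update u hollow_out h)
| delete_minimum t1 h1 t2 h2 t3 h3 h' : minp h = Some u ->
    exhaust destroy_step (update u hollow_out h) t1 h1 ->
    exhaust ranked_link_step h1 t2 h2 ->
    unify h2 t3 h3 ->
    record_min h3 h' ->
    delete_node h u
      (1 + t1 + #|` root_nodes h1| + t2 + \max_(v <- root_nodes h2) rank h2 v + t3)%N h'.

Definition reset_full_nodes h : {fmap nat -> node} :=
  let m := (nodes h).[& full_nodes h] in
  [fmap u : domf m => reset_rank m.[fsvalP u]].

(* [h'] is [h] after all but one of the parents of each node are removed. *)
Definition single_parents h h' : Prop :=
  [/\ nodes h' = nodes h, arcs h' `<=` arcs h &
      forall u, #|` parents h' u| = minn 1 #|` parents h u|].

Inductive nearest_full_ancestor h p : nat -> Prop :=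
| nearest_parent w : (p, w) \in arcs h -> full h p ->
    nearest_full_ancestor h p w
| nearest_up u w : (u, w) \in arcs h -> hollow h u ->
    nearest_full_ancestor h p u -> nearest_full_ancestor h p w.

(* In the second method, a full node all of whose proper ancestors are hollow,
   which is possible in a multi-root heap only, becomes a root. *)
Inductive rebuild h : nat -> heap -> Prop :=
| rebuild_meld t h1 h' :
    unify (Heap (reset_full_nodes h) fset0 None) t h1 ->
    record_min h1 h' ->
    rebuild h (num_nodes h + t)%N h'
| rebuild_ancestors h1 A h' :
    single_parents h h1 ->
    (forall p w, (p, w) \in A <-> full h w /\ nearest_full_ancestor h1 p w) ->
    record_min (Heap (reset_full_nodes h) A None) h' ->
    rebuild h (num_nodes h) h'.

Inductive op :=
| MakeHeap of nat
| FindMin of nat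
| Insert of Item & Key & nat
| DeleteMin of nat
| Meld of nat & nat
| DecreaseKey of Item & Key & nat
| Delete of Item & nat.

Record event := Event {
  ev_op : op;
  ev_size : nat; (* number of items, before the operation, of its first heap *)
  ev_time : nat }.

Definition state := {fmap nat -> heap}.

Definition fresh_node (s : state) x : Prop :=
  forall i h, s.[? i] = Some h -> x \notin domf (nodes h).

Section Rebuilding.
Context {R : realType}.
Variable c : R.

Definition too_large h : bool :=
  (c * (num_items h)%:R < (num_nodes h)%:R)%R.

Inductive maintain h : nat -> heap -> Prop :=
| maintain_keep : ~~ too_large h -> maintain h 0 h
| maintain_rebuild t h' : too_large h -> rebuild h t h' -> maintain h t h'.

(* A meld stores its result under the name of its first argument; the other
   operations that change a heap store the result under its old name. *)
Inductive perform (s : state) : event -> state -> Prop :=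
| perform_make_heap i : i \notin domf s ->
    perform s (Event (MakeHeap i) 0 1) s.[i <- empty_heap]
| perform_find_min i h : s.[? i] = Some h ->
    perform s (Event (FindMin i) (num_items h) 1) s
| perform_insert i h e k x h1 t h2 : s.[? i] = Some h ->
    (forall u, item h u <> Some e) -> fresh_node s x ->
    meld h (one_node x e k) h1 -> maintain h1 t h2 ->
    perform s (Event (Insert e k i) (num_items h) (2 + t)%N) s.[i <- h2]
| perform_delete_min i h e u t1 h1 t2 h2 : s.[? i] = Some h ->
    find_min h = Some e -> item h u = Some e ->
    delete_node h u t1 h1 -> maintain h1 t2 h2 ->
    perform s (Event (DeleteMin i) (num_items h) (t1 + t2)%N) s.[i <- h2]
| perform_meld i j h1 h2 h3 t h4 : i != j ->
    s.[? i] = Some h1 -> s.[? j] = Some h2 ->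
    (forall e u v, item h1 u = Some e -> item h2 v <> Some e) ->
    meld h1 h2 h3 -> maintain h3 t h4 ->
    perform s (Event (Meld i j) (num_items h1) (1 + t)%N) s.[~ j].[i <- h4]
| perform_decrease_key i h e k u nd x t1 h1 t2 h2 : s.[? i] = Some h ->
    (nodes h).[? u] = Some nd -> nd_item nd = Some e -> (k < nd_key nd)%O ->
    fresh_node s x -> decrease_key h u x k t1 h1 -> maintain h1 t2 h2 ->
    perform s (Event (DecreaseKey e k i) (num_items h) (t1 + t2)%N) s.[i <- h2]
| perform_delete i h e u t1 h1 t2 h2 : s.[? i] = Some h ->
    item h u = Some e -> delete_node h u t1 h1 -> maintain h1 t2 h2 ->
    perform s (Event (Delete e i) (num_items h) (t1 + t2)%N) s.[i <- h2].

(* [execution tr s]: the sequence of operations [tr], started with no heaps,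
   may lead to the heaps [s]. *)
Inductive execution : seq event -> state -> Prop :=
| execution_nil : execution [::] [fmap]
| execution_rcons tr s ev s' : execution tr s -> perform s ev s' ->
    execution (rcons tr ev) s'.

End Rebuilding.

(* The growth rate 1 or log n; one is added to the integer part of the binary
   logarithm because log 1 = 0. *)
Definition op_bound (ev : event) : nat :=
  match ev_op ev with
  | DeleteMin _ | Delete _ _ => (trunc_log 2 (ev_size ev)).+1
  | _ => 1
  end.

End Heaps.

Arguments node {disp} Key Item.
Arguments heap {disp} Key Item.
Arguments op {disp} Key Item.
Arguments event {disp} Key Item.
Arguments state {disp} Key Item.

(* Main.v *)
(** A virtual forest of ranked children drives the amortization. A full node
    of rank r has exactly one virtual child of each rank below r. A
    decrease-key that replaces u by a node of rank r - 2 hands over the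
    virtual children of rank below r - 2, and u, now hollow, keeps those of
    ranks r - 2 and r - 1. So every node of rank r, full or hollow, has
    virtual children of ranks r - 1 and r - 2, hence at least 2^(r/2)
    virtual descendants, and ranks are O(log N), N being the number of
    nodes. In a two-parent heap the children are handed over only virtually:
    they can still be reached from the new node through u, so they are not
    destroyed before it.

    Full virtual children of full nodes carry no potential, all other nodes
    and the arcs into them carry a constant one. A ranked link thus frees
    potential, an unranked link costs O(1), a decrease-key exposes at most
    two virtual children, and a deletion exposes O(log N) of them and leaves
    O(log N) roots. Each node carries a further constant A; since N > c n,
    the A (N - n) freed by a rebuilding that leaves n nodes pays for it, and
    N <= c n after each operation turns O(log N) into O(log n) and bounds
    the space. *)

Require Import Defs.
From mathcomp Require Import all_boot all_order all_algebra.
From mathcomp Require Import finmap reals zify lra.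

Set Implicit Arguments.
Unset Strict Implicit.
Unset Printing Implicit Defensive.

Import Order.TTheory GRing.Theory Num.Theory.

Section FsetSums.
Local Open Scope fset_scope.
Variables (I J : choiceType).
Implicit Types (A B : {fset I}) (F G : I -> nat).

Lemma leq_sum_fset A F G : (forall i, i \in A -> F i <= G i) ->
  \sum_(i <- A) F i <= \sum_(i <- A) G i.
Proof.
move=> FG; rewrite big_seq [leqRHS]big_seq; exact: leq_sum.
Qed.

Lemma leq_sum_fsub A B F : A `<=` B -> \sum_(i <- A) F i <= \sum_(i <- B) F i.
Proof.
move=> AB; have -> : A = [fset i in B | i \in A].
  by apply/fsetP => i; rewrite !inE /= andbC;
    case: (boolP (i \in A)) => // /(fsubsetP AB) ->.
by rewrite big_fset /= [leqRHS](bigID (mem A)) /= leq_addr.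
Qed.

Lemma leq_sum_fsetU A B F :
  \sum_(i <- A `|` B) F i <= \sum_(i <- A) F i + \sum_(i <- B) F i.
Proof.
rewrite (big_fsetID _ (mem A)) /=; apply: leq_add.
  by apply: leq_sum_fsub; apply/fsubsetP => i; rewrite !inE /= => /andP[].
by apply: leq_sum_fsub; apply/fsubsetP => i;
  rewrite !inE /= => /andP[/orP[->|]].
Qed.

Lemma leq_sum_imfset (f : J -> I) (A : {fset J}) F :
  \sum_(i <- [fset f j | j in A]) F i <= \sum_(j <- A) F (f j).
Proof.
elim/fset1U_rect: A => [|j A jA IH]; first by rewrite imfset0 !big_seq_fset0.
rewrite [leqRHS]big_fsetU1 //= imfsetU1;
  apply: leq_trans (leq_sum_fsetU _ _ _) _.
by rewrite big_seq_fset1 leq_add2l.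
Qed.

Lemma card_fset_sum A (P : pred I) :
  #|` [fset i in A | P i]| = \sum_(i <- A) P i.
Proof.
by rewrite card_fset_sum1 big_fset /= -big_mkcondr /=;
  under eq_bigl do rewrite /=.
Qed.

Lemma eq_of_card_le1 A a b : #|` A| <= 1 -> a \in A -> b \in A -> a = b.
Proof.
move=> A1 aA bA; have : [fset a; b] `<=` A by rewrite fsubUset !fsub1set aA.
by move=> /fsubset_leq_card/leq_trans/(_ A1); rewrite cardfs2; case: eqVneq.
Qed.

Lemma leq_card_fimage (f : I -> J) A : #|` [fset f i | i in A]| <= #|` A|.
Proof. exact: leq_imfset_card. Qed.

Lemma card_in_fimage A (f : I -> J) : {in A &, injective f} ->
  #|` [fset f i | i in A]| = #|` A|.
Proof. by move=> finj; rewrite card_in_imfset. Qed.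

Lemma card_leq_interval A (f : I -> nat) m n :
  {in A &, injective f} -> (forall i, i \in A -> m <= f i < m + n) ->
  #|` A| <= n.
Proof.
move=> finj fA; rewrite -(size_iota m n) cardfE -cardfE -(size_map f).
apply: uniq_leq_size; first by rewrite map_inj_in_uniq ?fset_uniq.
by move=> _ /mapP[i iA ->]; rewrite mem_iota fA.
Qed.

End FsetSums.

Section Heaps.
Local Open Scope fset_scope.
Local Open Scope fmap_scope.
Local Open Scope nat_scope.
Context {disp : Order.disp_t} {Key : orderType disp} {Item : Type}.
Variable kind : heap_kind.
Local Notation heap := (heap Key Item).
Implicit Types (h : heap) (g : nat -> option nat) (u v w x o p : nat).
Local Notation dom h := (domf (nodes h)).

Definition two_parent := if kind is TwoParent then true else false.

Lemma in_children h u w : (w \in children h u) = ((u, w) \in arcs h).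
Proof.
apply/imfsetP/idP => [[[a b]] /= | uw]; last by exists (u, w) => //=;
  rewrite inE uw /=.
by rewrite inE /= => /andP[ab /eqP <-] ->.
Qed.

Lemma in_parents h u w : (u \in parents h w) = ((u, w) \in arcs h).
Proof.
apply/imfsetP/idP => [[[a b]] /= | uw]; last by exists (u, w) => //=;
  rewrite inE uw /=.
by rewrite inE /= => /andP[ab /eqP <-] ->.
Qed.

Lemma rootP h u :
  reflect (u \in dom h /\ forall p, (p, u) \notin arcs h) (u \in root_nodes h).
Proof.
rewrite !inE /=; apply: (iffP andP) => -[uh].
  by move=> /eqP/fsetP up; split=> // p; rewrite -in_parents up.
by move=> up; split=> //; apply/eqP/fsetP => p;
  rewrite in_parents (negbTE (up p)).
Qed.

Lemma full_dom h u : full h u -> u \in dom h.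
Proof. by rewrite /full /item; case: fndP. Qed.

Lemma in_full_nodes h u : (u \in full_nodes h) = full h u.
Proof. by rewrite !inE /=; case: (boolP (full h u)) => [/full_dom ->|_];
  rewrite ?andbF. Qed.

Lemma rank_dom h u : 0 < rank h u -> u \in dom h.
Proof. by rewrite /rank; case: fndP. Qed.

Lemma nodes_update u f h v :
  (nodes (update u f h)).[? v] =
  if v == u then omap f (nodes h).[? u] else (nodes h).[? v].
Proof.
rewrite /update; case E: (nodes h).[? u] => [nd|] /=;
  last by case: eqP => // ->.
by rewrite fnd_set.
Qed.

Lemma dom_update u f h : dom (update u f h) = dom h.
Proof.
rewrite /update; case: fndP => // uh /=.
by apply/fsetP => v; rewrite !inE; case: eqP => // ->.
Qed.

Lemma arcs_update u f h : arcs (update u f h) = arcs h.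
Proof. by rewrite /update; case: (nodes h).[? u]. Qed.

Lemma minp_update u f h : minp (update u f h) = minp h.
Proof. by rewrite /update; case: (nodes h).[? u]. Qed.

(** * The virtual forest and the rank bound *)

Inductive reach (E : {fset nat * nat}) o : nat -> Prop :=
| reach_arc w : (o, w) \in E -> reach E o w
| reach_step p w : reach E o p -> (p, w) \in E -> reach E o w.

Definition conn (E : {fset nat * nat}) o w : Prop :=
  if two_parent then reach E o w else (o, w) \in E.

Lemma conn_last E o w : conn E o w ->
  exists2 p, (p, w) \in E & p = o \/ exists q, (q, p) \in E.
Proof.
rewrite /conn; case: two_parent => [[{}w ow|p {}w op pw]|ow].
- by exists o; auto.
- by exists p => //; right; case: op => [q|q q']; [exists o | exists q].
- by exists o; auto.
Qed.

Lemma conn_first E o w : conn E o w -> exists q, (o, q) \in E.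
Proof.
rewrite /conn; case: two_parent => [|ow]; last by exists w.
by elim=> [q oq|//]; exists q.
Qed.

Lemma conn_sub (E E' : {fset nat * nat}) o w : E `<=` E' -> conn E o w -> conn
  E' o w.
Proof.
move=> EE'; rewrite /conn; case: two_parent; last exact: (fsubsetP EE').
elim=> [{}w /(fsubsetP EE')|p {}w _ op /(fsubsetP EE')]; first exact: reach_arc.
exact: reach_step.
Qed.

Lemma conn_unroot E u o w : (forall p, (p, u) \notin E) -> o != u ->
  conn E o w -> conn [fset a in E | a.1 != u] o w.
Proof.
move=> uE ou; rewrite /conn; case: two_parent; last by rewrite !inE /= => ->.
elim=> [{}w ow|p {}w op IH pw]; first by apply: reach_arc; rewrite !inE /= ow.
apply: reach_step IH _; rewrite !inE /= pw /=; apply/eqP => pu; subst p.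
by case: op (uE) => [q|q q' _] qE /(_ _)/negP => [/(_ o)|/(_ q)]; apply.
Qed.

(* [g] maps a node to its virtual parent. In a two-parent heap the virtual
   parent is joined to the child by a path instead of an arc. The hypothesis
   of [valid_ranks] excludes only the virtual children that a node lost when
   a decrease-key made it hollow. *)
Record valid h g : Prop := Valid {
  valid_arc : forall p w, (p, w) \in arcs h -> p \in dom h /\ w \in dom h;
  valid_parents : forall w,
    #|` parents h w| <= if full h w || ~~ two_parent then 1 else 2;
  valid_child : forall w o, g w = Some o ->
    [/\ ranked h w, rank h w < rank h o & conn (arcs h) o w];
  valid_inj : forall w w' o, g w = Some o -> g w' = Some o ->
    rank h w = rank h w' -> w = w';
  valid_ranks : forall o j, j < rank h o -> full h o || (rank h o <= j.+2) ->
    exists2 w, g w = Some o & rank h w = j }.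

Lemma valid_conn_dom h g w o : valid h g -> g w = Some o ->
  o \in dom h /\ w \in dom h.
Proof.
move=> V gw; have [_ _ C] := valid_child V gw; split.
  by have [q /(valid_arc V)[]] := conn_first C.
by have [q /(valid_arc V)[]] := conn_last C.
Qed.

Lemma valid_root h g u : valid h g -> u \in root_nodes h -> g u = None.
Proof.
move=> V /rootP[_ up]; case E: (g u) => [o|] //.
by have [_ _ /conn_last[p pu]] := valid_child V E;
  rewrite (negbTE (up p)) in pu.
Qed.

Lemma unique_parent h g w p q : valid h g -> full h w || ~~ two_parent ->
  (p, w) \in arcs h -> (q, w) \in arcs h -> p = q.
Proof.
by move=> V fw; rewrite -!in_parents; apply: eq_of_card_le1;
  have := valid_parents V w; rewrite fw.
Qed.

Section RankBound.
Variables (h : heap) (g : nat -> option nat).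
Hypothesis V : valid h g.
Local Notation anc n z := (iter n (obind g) (Some z)).

Lemma rank_anc n a b : anc n a = Some b -> rank h a <= rank h b.
Proof.
elim: n b => [b [->] //|n IH b] /=.
case E: (anc n a) => [z|] //= /(valid_child V)[_ zb _].
exact: leq_trans (IH _ E) (ltnW zb).
Qed.

Lemma anc_child n a o z : g a = Some o -> anc n.+1 a = Some z ->
  rank h o <= rank h z.
Proof. by move=> ga; rewrite iterSr /= ga => /rank_anc. Qed.

Lemma anc_sibling m n z a b o : g a = Some o -> g b = Some o -> m <= n ->
  anc m z = Some a -> anc n z = Some b -> a = b.
Proof.
move=> ga gb mn za; rewrite -(subnK mn) iterD za.
case: (n - m) => [[]//|k /(anc_child ga)].
by have [_ lt _] := valid_child V gb; rewrite leqNgt lt.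
Qed.

Lemma rank_descendants r o : rank h o = r -> o \in dom h ->
  exists2 T : {fset nat}, T `<=` dom h & 2 ^ r./2 <= #|` T| /\
    forall z, z \in T -> exists n, anc n z = Some o.
Proof.
elim/ltn_ind: r o => -[|[|r]] IH o ro oh.
- by exists [fset o]; rewrite ?fsub1set // cardfs1; split=> // z /fset1P ->;
    exists 0.
- by exists [fset o]; rewrite ?fsub1set // cardfs1; split=> // z /fset1P ->;
    exists 0.
have [] // := @valid_ranks _ _ V o r.+1; rewrite ?ro ?ltnSn ?orbT //;
  first by lia.
move=> a ga ra.
have [] // := @valid_ranks _ _ V o r; rewrite ?ro ?ltnSn ?orbT //.
move=> b gb rb.
have [_ ah] := valid_conn_dom V ga; have [_ bh] := valid_conn_dom V gb.
have [Ta Tah [ca Ta_]] := IH _ (ltnSn _) a ra ah.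
have [Tb Tbh [cb Tb_]] := IH _ (ltnW (ltnSn _)) b rb bh.
exists (Ta `|` Tb); first by rewrite fsubUset Tah.
split; last first.
  move=> z /fsetUP[/Ta_|/Tb_] [n nz]; exists n.+1; rewrite iterS nz //.
rewrite cardfsU (_ : Ta `&` Tb = fset0) ?cardfs0 ?subn0.
  apply: leq_trans (leq_add ca cb); rewrite /= expnS mul2n -addnn leq_add //.
  by rewrite leq_exp2l // uphalf_half leq_addl.
apply/fsetP => z; rewrite in_fset0 inE;
  apply/negP => /andP[/Ta_[m za] /Tb_[n zb]].
have ab : a = b.
  by case: (leqP m n) => [|/ltnW] mn;
    [apply: anc_sibling mn za zb | apply/esym; apply: anc_sibling mn zb za];
      eauto.
by move: ra; rewrite ab rb; lia.
Qed.

Lemma rank_leq_log o : rank h o <= (2 * trunc_log 2 (num_nodes h)).+1.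
Proof.
case: (posnP (rank h o)) => [->//|/rank_dom oh].
have [T Th [cT _]] := rank_descendants erefl oh.
have := trunc_log_max (isT : 1 < 2) (leq_trans cT (fsubset_leq_card Th)).
by rewrite -/(num_nodes h); have := odd_double_half (rank h o); case: odd; lia.
Qed.

End RankBound.


(** * The potential *)

Section Potential.
Variable A : nat.

Definition shielded h g w : bool := full h w && oapp (full h) false (g w).

(* The second unit of an arc below a full node pays for cutting the child out of
   its parent in a decrease-key; the first pays for the destruction of the
   parent. The two units of an unshielded node in [potential] pay, once it is a
   root, for its ranked link and for its visit in a deletion. *)
Definition arc_weight h g (a : nat * nat) : nat :=
  ~~ shielded h g a.2 * (1 + full h a.1).

Definition potential h g : nat :=
  A * num_nodes h + 2 * (\sum_(w <- dom h) ~~ shielded h g w) +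
  \sum_(a <- arcs h) arc_weight h g a.

Lemma arc_weight_le2 h g a : arc_weight h g a <= 2.
Proof. by rewrite /arc_weight; case: shielded; case: full. Qed.

Lemma shielded_root h g u : valid h g -> u \in root_nodes h -> shielded h g u =
  false.
Proof. by move=> V uR; rewrite /shielded (valid_root V uR) andbF. Qed.

Lemma valid_ext h h' g : dom h' = dom h -> arcs h' = arcs h ->
  full h' =1 full h -> rank h' =1 rank h -> ranked h' =1 ranked h ->
  valid h g -> valid h' g /\ potential h' g = potential h g.
Proof.
move=> Ed Ea Ef Er Eb V; split.
  split.
  - by move=> p w; rewrite Ea Ed; exact: (valid_arc V).
  - by move=> w; rewrite /parents Ea Ef; exact: (valid_parents V).
  - by move=> w o; rewrite Ea Er Er Eb; exact: (valid_child V).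
  - by move=> w w' o; rewrite Er Er; exact: (valid_inj V).
  - move=> o j; rewrite Er Ef => jo fo; have [w gw rw] := valid_ranks V jo fo.
    by exists w; rewrite ?Er.
have Es w : shielded h' g w = shielded h g w.
  by rewrite /shielded Ef; congr andb; case: (g w) => //= o; rewrite Ef.
rewrite /potential /num_nodes Ed Ea; congr (_ + 2 * _ + _).
  by apply: eq_bigr => w _; rewrite Es.
by apply: eq_bigr => a _; rewrite /arc_weight Es Ef.
Qed.

Lemma valid_set_minp m h g : valid h g -> valid (set_minp m h) g.
Proof. by case=> *; split. Qed.

Lemma full_update_hollow u h v :
  full (update u hollow_out h) v = (v != u) && full h v.
Proof.
by rewrite /full /item nodes_update; case: eqP => //= _; case: (nodes h).[? u].
Qed.

Lemma rank_update u f h v : (forall nd, nd_rank (f nd) = nd_rank nd) ->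
  rank (update u f h) v = rank h v.
Proof.
move=> fr; rewrite /rank nodes_update; case: eqP => // ->.
by case: (nodes h).[? u] => //= nd.
Qed.

Lemma ranked_update u f h v : (forall nd, nd_ranked (f nd) = nd_ranked nd) ->
  ranked (update u f h) v = ranked h v.
Proof.
move=> fr; rewrite /ranked nodes_update; case: eqP => // ->.
by case: (nodes h).[? u] => //= nd.
Qed.

Lemma item_update u f h v : (forall nd, nd_item (f nd) = nd_item nd) ->
  item (update u f h) v = item h v.
Proof.
move=> fr; rewrite /item nodes_update; case: eqP => // ->.
by case: (nodes h).[? u] => //= nd; rewrite fr.
Qed.

Lemma full_update u f h v : (forall nd, nd_item (f nd) = nd_item nd) ->
  full (update u f h) v = full h v.
Proof. by move=> fi; rewrite /full item_update. Qed.

Lemma unshielded_bound h h' g g' (Z : {fset nat}) :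
  (forall w, w \in dom h -> w \notin Z -> shielded h g w -> shielded h' g' w) ->
  \sum_(w <- dom h) ~~ shielded h' g' w <=
    \sum_(w <- dom h) ~~ shielded h g w + #|` Z|.
Proof.
move=> mono; apply: (@leq_trans (\sum_(w <- dom h) (~~ shielded h g w + (w \in
  Z)))).
  apply: leq_sum_fset => w wh; have := mono w wh.
  by case: (w \in Z); case: (shielded h g w); case: shielded => // /(_ isT isT).
rewrite big_split leq_add2l -card_fset_sum fsubset_leq_card //.
by apply/fsubsetP => w; rewrite !inE /= => /andP[].
Qed.

Lemma arcs_into_bound h g (Z : {fset nat}) : valid h g ->
  (forall w, w \in Z -> full h w) -> \sum_(a <- arcs h) (a.2 \in Z) <= #|` Z|.
Proof.
move=> V fZ; rewrite -card_fset_sum.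
rewrite -(@card_in_fimage _ _ _ snd); last first.
  move=> [p w] [q v]; rewrite !inE /= => /andP[pw wZ] /andP[qv vZ] wv; subst v.
  by rewrite (unique_parent V _ pw qv) // fZ.
by apply/fsubset_leq_card/fsubsetP => _ /imfsetP[a /= + ->];
  rewrite !inE => /andP[].
Qed.

Lemma valid_hollow_out h g u : valid h g -> full h u ->
  valid (update u hollow_out h) g /\
  potential (update u hollow_out h) g <= potential h g + 4 * (rank h u).+1.
Proof.
move=> V fu; set h' := update u hollow_out h.
have Ef := full_update_hollow u h; rewrite -/h' in Ef.
have Er v : rank h' v = rank h v by apply: rank_update.
have Eb v : ranked h' v = ranked h v by apply: ranked_update.
have Ea : arcs h' = arcs h by apply: arcs_update.
have Ed : dom h' = dom h by apply: dom_update.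
split.
  split.
  - by move=> p w; rewrite Ea Ed; exact: (valid_arc V).
  - move=> w; rewrite /parents Ea Ef; apply: leq_trans (valid_parents V w) _.
    by case: eqP => _ //=; case: full; case: two_parent.
  - by move=> w o; rewrite Ea !Er Eb; exact: (valid_child V).
  - by move=> w w' o; rewrite !Er; exact: (valid_inj V).
  - move=> o j; rewrite Er Ef => jo fo.
    have [|w gw rw] := valid_ranks V jo; last by exists w; rewrite ?Er.
    by move: fo; case: full; rewrite ?andbF.
pose Z := u |` [fset w in dom h | full h w && (g w == Some u)].
have fZ w : w \in Z -> full h w by rewrite !inE => /orP[/eqP->|/and3P[]].
have cZ : #|` Z| <= (rank h u).+1.
  rewrite cardfsU1 -add1n leq_add ?leq_b1 //.
  apply: (@card_leq_interval _ _ (rank h) 0).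
    move=> w w'; rewrite !inE /= => /and3P[_ _ /eqP gw] /and3P[_ _ /eqP gw'].
    exact: (valid_inj V gw gw').
  by move=> w; rewrite !inE /= => /and3P[_ _ /eqP/(valid_child V)[]].
have mono w : w \in dom h -> w \notin Z -> shielded h g w -> shielded h' g w.
  rewrite !inE negb_or /shielded => wh /andP[wu]; rewrite wh Ef wu /=.
  case: full => //=; case E: (g w) => [o|] //= ou.
  by rewrite Ef andbC => -> /=; apply: contraNneq ou => ->.
rewrite /potential /num_nodes Ed Ea.
have := unshielded_bound mono.
have : \sum_(a <- arcs h) arc_weight h' g a <= \sum_(a <- arcs h) arc_weight h
  g a + 2 * #|` Z|.
  apply: (@leq_trans (\sum_(a <- arcs h) (arc_weight h g a + 2 * (a.2 \in Z)))).
    apply: leq_sum_fset => -[p w] /= pw.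
    have [_ wh] := valid_arc V pw; have := mono w wh.
    case: (w \in Z) => [_|/(_ isT) sw];
      first by rewrite (leq_trans (arc_weight_le2 _ _ _)) ?leq_addl.
    rewrite addn0 /arc_weight /= leq_mul // ?Ef; last by case: eqP; case: full.
    by move: sw; case: (shielded h g w) => [->//|_]; case: shielded.
  rewrite big_split leq_add2l -big_distrr /= leq_mul2l /=.
  exact: arcs_into_bound V fZ.
lia.
Qed.

Lemma destroy_amortized h g t h' : valid h g -> destroy_step h t h' ->
  exists g', [/\ valid h' g', dom h' `<=` dom h &
                 potential h' g' + t <= potential h g].
Proof.
move=> V [u uR /andP[uh hu]].
have [_ up] := rootP _ _ uR.
set h1 := Heap _ _ _; pose g' w := if g w == Some u then None else g w.
have Ed : dom h1 = dom h `\ u by exact: domf_rem.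
have En v : (nodes h1).[? v] = if v == u then None else (nodes h).[? v].
  by rewrite /= fnd_rem1; case: eqP.
have Ef v : full h1 v = full h v.
  by rewrite /full /item En; case: eqP => // ->; move: hu; rewrite /full /item;
    case: obind.
have Er v : v != u -> rank h1 v = rank h v by rewrite /rank En => /negbTE->.
have Eb v : v != u -> ranked h1 v = ranked h v by rewrite /ranked En =>
  /negbTE->.
have g'E w o : g' w = Some o -> [/\ g w = Some o, o != u & w != u].
  rewrite /g'; case: (eqVneq (g w) (Some u)) => // gwu gw; split=> //.
    by apply: contraNneq gwu => <-; rewrite gw.
  by apply: contra_eq_neq gw => ->; rewrite (valid_root V uR).
have Es w : shielded h1 g' w = shielded h g w.
  rewrite /shielded Ef /g'; congr andb.
  case: (eqVneq (g w) (Some u)) => [->/=|_]; first by rewrite (negbTE hu).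
  by case: (g w) => //= o; rewrite Ef.
exists g'; split.
- split.
  + move=> p w; rewrite Ed !inE /= => /andP[pw ->] /=.
    have [-> ->] := valid_arc V pw; rewrite andbT; split=> //.
    by apply: contraTneq pw => ->; exact: up.
  + move=> w; rewrite Ef; apply: leq_trans (valid_parents V w).
    apply/fsubset_leq_card/fsubsetP => p; rewrite !in_parents !inE /=.
    by case/andP.
  + move=> w o /g'E[gw ou wu]; rewrite Eb // !Er //.
    have [-> -> C] := valid_child V gw; split=> //; exact: conn_unroot.
  + move=> w w' o /g'E[gw ou wu] /g'E[gw' _ w'u]; rewrite !Er //.
    exact: (valid_inj V gw gw').
  + move=> o j jo; have ou : o != u.
      by apply: contraTneq jo => ->; rewrite /rank En eqxx.
    move: jo; rewrite Ef Er // => jo fo; have [w gw rw] := valid_ranks V jo fo.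
    exists w; last by rewrite Er //; apply: contra_eq_neq gw => ->;
      rewrite (valid_root V uR).
    by rewrite /g' gw; case: eqP => // -[/eqP]; rewrite (negbTE ou).
- by rewrite Ed fsubD1set.
pose X := [fset a in arcs h | a.1 != u].
pose Y := [fset a in arcs h | ~~ (a.1 != u)].
have Ew : \sum_(w <- dom h1) ~~ shielded h1 g' w = \sum_(w <- dom h `\ u) ~~
  shielded h g w.
  by rewrite Ed; apply: eq_bigr => w _; rewrite Es.
have Ea : \sum_(a <- arcs h1) arc_weight h1 g' a = \sum_(a <- X) arc_weight h g
  a.
  by apply: eq_bigr => a _; rewrite /arc_weight Es Ef.
rewrite /potential /num_nodes Ew Ea Ed (cardfsD1 u (dom h)) uh (big_fsetD1 u
  uh) /=.
rewrite (big_fsetID _ (fun a => a.1 != u) (arcs h)) /= -/X -/Y.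
have -> : #|` children h u| = \sum_(a <- Y) arc_weight h g a.
  rewrite card_fset_sum1.
  rewrite (_ : children h u = [fset a.2 | a in Y]); last first.
    by apply: eq_imfset => // a; rewrite !inE negbK.
  rewrite big_imfset /=; last first.
    move=> [p w] [q v];
      rewrite !inE !negbK /= => /andP[_ /eqP->] /andP[_ /eqP->].
    by move=> ->.
  rewrite big_seq [RHS]big_seq; apply: eq_bigr => -[p w].
  rewrite !inE /= negbK => /andP[pw /eqP pu]; subst p.
  rewrite /arc_weight (negbTE hu) /= muln1; case sw: shielded => //.
  move: sw; rewrite /shielded; case/andP => fw; case gw: (g w) => [o|] //= fo.
  have [_ _ /conn_last[p pw']] := valid_child V gw.
  have -> : p = u by apply: unique_parent V _ pw' pw; rewrite fw.
  by case=> [uo|[q]]; [rewrite -uo (negbTE hu) in fo | rewrite (negbTE (up q))].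
by rewrite (shielded_root V uR) /=; lia.
Qed.


(** * Links and deletions *)

Definition roots_full h : Prop := forall u, u \in root_nodes h -> full h u.

Section Link.
Variables (h h' : heap) (u v : nat).
Hypotheses (vR : v \in root_nodes h) (Ed : dom h' = dom h)
  (Ea : arcs h' = (u, v) |` arcs h).

Lemma link_roots : root_nodes h' = root_nodes h `\ v.
Proof.
apply/fsetP => w; rewrite in_fsetD1;
  apply/rootP/andP => [[wh pw]|[wv /rootP[wh pw]]].
  split; first by apply: contraTneq (pw u) => ->; rewrite Ea !inE eqxx.
  by apply/rootP; rewrite -Ed; split=> // p; have := pw p;
    rewrite Ea !inE negb_or => /andP[].
split=> [|p]; first by rewrite Ed.
by rewrite Ea !inE (negbTE (pw p)) orbF xpair_eqE (negbTE wv) andbF.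
Qed.

Lemma link_roots_card : #|` root_nodes h'| + 1 = #|` root_nodes h|.
Proof. by rewrite link_roots (cardfsD1 v (root_nodes h)) vR addnC. Qed.

Lemma link_roots_full : full h' =1 full h -> roots_full h -> roots_full h'.
Proof.
by move=> Ef F w; rewrite link_roots Ef in_fsetD1 => /andP[_ /F].
Qed.

Lemma link_parents w :
  #|` parents h' w| <= if w == v then 1 else #|` parents h w|.
Proof.
have [_ pv] := rootP _ _ vR; case: eqP => [->|wv].
  rewrite -(cardfs1 u); apply/fsubset_leq_card/fsubsetP => p.
  by rewrite in_parents Ea !inE (negbTE (pv p)) orbF xpair_eqE eqxx andbT.
apply/fsubset_leq_card/fsubsetP => p; rewrite !in_parents Ea !inE xpair_eqE.
by move/eqP/negbTE: wv => ->; rewrite andbF.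
Qed.

Lemma link_arc_notin : (u, v) \notin arcs h.
Proof. by have [] := rootP _ _ vR. Qed.

End Link.

Lemma linkableP h u v : linkable h u v ->
  [/\ u \in root_nodes h, v \in root_nodes h, u != v, full h u & full h v].
Proof. by case/and5P => ? ? ? ? /andP[]. Qed.

Lemma ranked_update_neq u f h v : v != u -> ranked (update u f h) v = ranked h
  v.
Proof. by move=> vu; rewrite /ranked nodes_update (negbTE vu). Qed.

Lemma link_arc_amortized h g u v : valid h g -> u \in root_nodes h ->
  v \in root_nodes h -> full h u -> full h v ->
  let h' := link_arc false u v h in
  [/\ valid h' g, dom h' = dom h, full h' =1 full h,
      root_nodes h' = root_nodes h `\ v &
      potential h' g <= potential h g + 2].
Proof.
move=> V uR vR fu fv h'.
have Ed : dom h' = dom h by exact: dom_update.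
have Ea : arcs h' = (u, v) |` arcs h by rewrite /h' /= arcs_update.
have Ef w : full h' w = full h w by exact: full_update.
have Er w : rank h' w = rank h w by exact: rank_update.
have Eb w : w != v -> ranked h' w = ranked h w by exact: ranked_update_neq.
have Es w : shielded h' g w = shielded h g w.
  by rewrite /shielded Ef; congr andb; case: (g w) => //= o; rewrite Ef.
split=> //; last 2 first.
- exact: (link_roots Ed Ea).
- rewrite /potential /num_nodes Ed Ea big_fsetU1 ?link_arc_notin //=.
  under eq_bigr => w _ do rewrite Es.
  under [X in _ + (_ + X)]eq_bigr => a _ do rewrite /arc_weight Es Ef
    -/(arc_weight h g a).
  by have := arc_weight_le2 h' g (u, v); lia.
have uh := full_dom fu; have vh := full_dom fv.
split.
- by move=> p w; rewrite Ed Ea !inE => /orP[/eqP[-> ->] //|];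
    exact: (valid_arc V).
- move=> w; rewrite Ef; apply: leq_trans (link_parents vR Ea w) _.
  by case: eqP => [->|_]; [rewrite fv | exact: (valid_parents V)].
- move=> w o gw; have [bw rw C] := valid_child V gw; rewrite !Er Eb.
    by split=> //; rewrite Ea; apply: conn_sub C; exact: fsubsetUr.
  by apply: contra_eq_neq gw => ->; rewrite (valid_root V vR).
- by move=> w w' o; rewrite !Er; exact: (valid_inj V).
- by move=> o j; rewrite Er Ef => jo fo; have [w gw rw] := valid_ranks V jo fo;
    exists w; rewrite ?Er.
Qed.

Lemma ranked_link_amortized h g t h' : valid h g -> ranked_link_step h t h' ->
  [/\ exists2 g', valid h' g' & potential h' g' + 2 * t <= potential h g,
      dom h' = dom h, #|` root_nodes h'| + t = #|` root_nodes h| &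
      roots_full h -> roots_full h'].
Proof.
move=> V [u v /linkableP[uR vR uv fu fv] ruv].
set h1 := update _ _ _.
have Ed : dom h1 = dom h by rewrite dom_update; exact: dom_update.
have Ea : arcs h1 = (u, v) |` arcs h by rewrite arcs_update /= arcs_update.
have Ef w : full h1 w = full h w by rewrite full_update //; exact: full_update.
have uh := full_dom fu; have vh := full_dom fv.
have Er w : rank h1 w = rank h w + (w == u).
  rewrite /h1 {1}/rank nodes_update; case: eqP => [->|_]; last first.
    by rewrite addn0; exact: rank_update.
  have -> : (nodes (link_arc true u v h)).[? u] = (nodes h).[? u].
    by rewrite /= nodes_update (negbTE uv).
  by rewrite /rank; case: fndP uh => //= *; rewrite addn1.
have Eb w : ranked h1 w = (w == v) || ranked h w.
  rewrite ranked_update // /ranked /= nodes_update.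
  by case: eqP => // ->; case: fndP vh.
pose g' w := if w == v then Some u else g w.
have gu : g u = None by exact: valid_root V uR.
have gv : g v = None by exact: valid_root V vR.
have rD w o : g w = Some o -> rank h1 w = rank h w.
  by move=> gw; rewrite Er; case: eqP gw => [->|]; rewrite ?gu ?addn0.
split=> //; last 2 first.
- exact: (link_roots_card vR Ed Ea).
- exact: (link_roots_full Ed Ea).
exists g'; last first.
  have Es w : shielded h1 g' w = (w == v) || shielded h g w.
    rewrite /shielded Ef /g'; case: eqP => [->|_]; first by rewrite fv /= Ef fu.
    by congr andb; case: (g w) => //= o; rewrite Ef.
  rewrite /potential /num_nodes Ed Ea big_fsetU1 ?link_arc_notin //=.
  rewrite !(big_fsetD1 v vh) /= {1}/arc_weight !Es eqxx /= (shielded_root V vR).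
  rewrite (_ : \sum_(w <- _) _ = \sum_(w <- dom h `\ v) ~~ shielded h g w);
    last first.
    by rewrite big_seq [RHS]big_seq; apply: eq_bigr => w;
      rewrite !inE Es => /andP[/negbTE->].
  rewrite (_ : \sum_(a <- arcs h) arc_weight h1 g' a = \sum_(a <- arcs h)
    arc_weight h g a).
    by rewrite mul0n /=; lia.
  rewrite big_seq [RHS]big_seq; apply: eq_bigr => -[p w] pw.
  rewrite /arc_weight /= Es Ef; case: eqP => // wv.
  by have [_ /(_ p)] := rootP _ _ vR; rewrite -wv pw.
split.
- by move=> p w; rewrite Ed Ea !inE => /orP[/eqP[-> ->] //|];
    exact: (valid_arc V).
- move=> w; rewrite Ef; apply: leq_trans (link_parents vR Ea w) _.
  by case: eqP => [->|_]; [rewrite fv | exact: (valid_parents V)].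
- move=> w o; rewrite Eb /g'; case: eqP => [-> [<-]|wv gw].
    rewrite !Er (negbTE (_ : v != u)) 1?eq_sym // eqxx ruv addn0 addn1;
      split=> //.
    rewrite Ea /conn; case: two_parent; last exact: fset1U1.
    by apply: reach_arc; exact: fset1U1.
  have [bw rw C] := valid_child V gw; rewrite (rD _ _ gw) Er; split=> //.
    exact: leq_trans rw (leq_addr _ _).
  by rewrite Ea; apply: conn_sub C; exact: fsubsetUr.
- have lt w : g w = Some u -> rank h w < rank h v.
    by move=> /(valid_child V)[_ + _]; rewrite ruv.
  have rv : rank h1 v = rank h v by rewrite Er eq_sym (negbTE uv) addn0.
  move=> w w' o; rewrite /g'; case: eqP => [->|wv]; case: eqP => [->|w'v] //.
  + by move=> [<-] gw'; rewrite (rD _ _ gw') rv => E; have := lt _ gw';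
      rewrite E ltnn.
  + by move=> gw [uo]; subst o; rewrite (rD _ _ gw) rv => E; have := lt _ gw;
      rewrite E ltnn.
  + by move=> gw gw'; rewrite (rD _ _ gw) (rD _ _ gw');
      exact: (valid_inj V gw gw').
move=> o j; rewrite Er Ef.
have old w : g w = Some o -> rank h w = j -> exists2 w, g' w = Some o & rank h1
  w = j.
  move=> gw rw; exists w; last by rewrite (rD _ _ gw).
  by rewrite /g'; case: eqP gw => // ->; rewrite gv.
case: eqP => [ou|_]; last first.
  by rewrite addn0 => jo fo; have [w] := valid_ranks V jo fo; exact: old.
subst o => jo _; case: (ltngtP j (rank h u)) => [ju|uj|->]; last 2 first.
- by move: jo; rewrite addn1 ltnS leqNgt uj.
- by exists v; rewrite /g' ?eqxx // Er eq_sym (negbTE uv) addn0.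
by have [|w] := valid_ranks V ju; [rewrite fu | exact: old].
Qed.


Lemma destroy_star_amortized h g t h' : valid h g -> star destroy_step h t h' ->
  exists g', [/\ valid h' g', dom h' `<=` dom h &
                 potential h' g' + t <= potential h g].
Proof.
move=> V st; elim: st g V => [{}h g V|{}h t1 h1 t2 h2 s1 _ IH g V].
  by exists g; rewrite addn0.
have [g1 [V1 d1 p1]] := destroy_amortized V s1.
have [g2 [V2 d2 p2]] := IH _ V1.
by exists g2; split=> //; [exact: fsubset_trans d2 d1 | lia].
Qed.

Lemma ranked_star_amortized h g t h' : valid h g -> star ranked_link_step h t
  h' ->
  [/\ exists2 g', valid h' g' & potential h' g' + 2 * t <= potential h g,
      dom h' = dom h, #|` root_nodes h'| + t = #|` root_nodes h| &
      roots_full h -> roots_full h'].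
Proof.
move=> V st; elim: st g V => [{}h g V|{}h t1 h1 t2 h2 s1 _ IH g V].
  by split=> //; [exists g; rewrite ?muln0 ?addn0 | rewrite addn0].
have [[g1 V1 p1] d1 r1 f1] := ranked_link_amortized V s1.
have [[g2 V2 p2] d2 r2 f2] := IH _ V1.
split; [by exists g2 => //; lia | by rewrite d2 | by lia | by move=> /f1].
Qed.

Lemma unranked_star_amortized h g t h' : valid h g ->
  star unranked_link_step h t h' ->
  [/\ valid h' g /\ potential h' g <= potential h g + 2 * t,
      dom h' = dom h, #|` root_nodes h'| + t = #|` root_nodes h| &
      full h' =1 full h].
Proof.
move=> V st; elim: st V => [{}h V|{}h t1 h1 t2 h2 s1 _ IH V].
  by split=> //; rewrite ?addn0.
case: s1 IH => u v /linkableP[uR vR uv fu fv] IH.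
have [V1 d1 f1 r1 p1] := link_arc_amortized V uR vR fu fv.
have [[V2 p2] d2 r2 f2] := IH V1.
split; [split=> //; lia | by rewrite d2 | | by move=> w; rewrite f2 f1].
by rewrite (cardfsD1 v (root_nodes h)) vR -r1; lia.
Qed.

Lemma exhaust_destroy_roots_full h t h' : exhaust destroy_step h t h' ->
  roots_full h'.
Proof.
move=> [_ stop] u uR; case: (boolP (full h' u)) => // hu.
have [uh _] := rootP _ _ uR.
by case: (stop _ _ (@destroy_root _ _ _ _ _ uR _)); rewrite /hollow uh.
Qed.

Lemma key_le_total h u v : u \in dom h -> v \in dom h ->
  key_le h u v || key_le h v u.
Proof.
by rewrite /key_le; case: fndP => // uh _; case: fndP => // vh _;
  exact: Order.TotalTheory.le_total.
Qed.

Lemma exhaust_ranked_roots h t h' : roots_full h' ->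
  exhaust ranked_link_step h t h' ->
  #|` root_nodes h'| <= (\max_(v <- root_nodes h') rank h' v).+1.
Proof.
move=> F [_ stop]; apply: (@card_leq_interval _ _ (rank h') 0); last first.
  by move=> u uR; rewrite add0n ltnS; exact: leq_bigmax_seq.
move=> u v uR vR ruv; apply/eqP; case: eqVneq => // uv.
have [[uh _] [vh _]] := (rootP _ _ uR, rootP _ _ vR).
case/orP: (key_le_total uh vh) => kuv.
- case: (stop _ _ (ranked_link (u := u) (v := v) _ _)) => //.
  by rewrite /linkable uR vR uv !F.
case: (stop _ _ (ranked_link (u := v) (v := u) _ _)) => //.
by rewrite /linkable uR vR eq_sym uv !F.
Qed.

Definition minp_root h : Prop :=
  kind = MultiRoot \/ forall m, minp h = Some m -> m \in root_nodes h /\ full h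
    m.

Lemma record_min_valid h g h' : valid h g -> record_min h h' ->
  [/\ valid h' g, minp_root h', nodes h' = nodes h & arcs h' = arcs h].
Proof.
move=> V [r0|m [mR fm _]]; split=> //; try exact: valid_set_minp; right=> //.
by move=> _ /= [<-].
Qed.

Lemma unify_amortized h g t h' : valid h g -> unify kind h t h' ->
  [/\ valid h' g, potential h' g <= potential h g + 2 * t,
      dom h' = dom h, t <= #|` root_nodes h| & full h' =1 full h].
Proof.
rewrite /unify => V; have ex : exhaust unranked_link_step h t h' ->
  [/\ valid h' g, potential h' g <= potential h g + 2 * t,
      dom h' = dom h, t <= #|` root_nodes h| & full h' =1 full h].
  move=> [st _]; have [[V' p'] d' r' f'] := unranked_star_amortized V st.
  by split=> //; rewrite -r' leq_addl.
by case: kind => // -[-> ->]; rewrite addn0.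
Qed.

Lemma potential_eq h h' g : nodes h' = nodes h -> arcs h' = arcs h ->
  potential h' g = potential h g.
Proof. by case: h h' => ? ? ? [? ? ?] /= -> ->. Qed.

Lemma delete_node_amortized h g u t h' : valid h g -> minp_root h -> full h u ->
  delete_node kind h u t h' ->
  exists g', [/\ valid h' g', minp_root h', dom h' `<=` dom h &
    potential h' g' + t <= potential h g + 18 * (trunc_log 2 (num_nodes h)).+1].
Proof.
move=> V M fu; have rk := rank_leq_log V u.
have [V0 p0] := valid_hollow_out V fu.
case=> [mu|t1 h1 t2 h2 t3 h3 {}h' mu ex1 ex2 un3 rm].
  exists g; split=> //; last by lia.
    case: M => M; [by left | right=> m; rewrite minp_update => mm].
    have [/rootP[mh pm] fm] := M m mm; split; last first.
      by rewrite full_update_hollow fm andbT; apply/eqP => E; subst m.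
    by apply/rootP; rewrite dom_update arcs_update.
  by rewrite dom_update.
have [g1 [V1 d1 p1]] := destroy_star_amortized V0 (proj1 ex1).
have F1 := exhaust_destroy_roots_full ex1.
have [[g2 V2 p2] d2 r2 /(_ F1) F2] := ranked_star_amortized V1 (proj1 ex2).
have r2' := exhaust_ranked_roots F2 ex2.
have [V3 p3 d3 r3 f3] := unify_amortized V2 un3.
have [V4 M4 En Ea] := record_min_valid V3 rm.
rewrite dom_update in d1.
have mx : \max_(v <- root_nodes h2) rank h2 v <= (2 * trunc_log 2 (num_nodes
  h)).+1.
  apply/bigmax_leqP_seq => v _ _; apply: leq_trans (rank_leq_log V2 v) _.
  rewrite ltnS leq_mul2l /=; apply: leq_trunc_log.
  by rewrite /num_nodes d2 fsubset_leq_card.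
exists g2; split=> //; first by rewrite En d3 d2.
by rewrite (potential_eq _ En Ea); lia.
Qed.


(** * Decrease-key *)

Section SplitNode.
Variables (h : heap) (g : nat -> option nat) (u x : nat) (k : Key)
  (M : {fset nat}).
Hypotheses (V : valid h g) (fu : full h u) (xh : x \notin dom h)
  (mov : movable kind h u M).
Let h' := split_node kind h u x k M.

Definition moved_ghost w : option nat :=
  if (g w == Some u) && (rank h w < rank h u - 2) then Some x else g w.

Definition moved_arc (a : nat * nat) : nat * nat :=
  if (a.1 == u) && (a.2 \in M) then (x, a.2) else a.

Lemma split_neq : u != x.
Proof. by apply: contraNneq xh => <-; exact: full_dom. Qed.

Lemma movable_child w : w \in M -> (u, w) \in arcs h.
Proof. by have [/fsubsetP MC _] := mov; move=> /MC; rewrite in_children. Qed.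

Lemma movable_two_parent w : two_parent -> (w \in M) = false.
Proof.
rewrite /two_parent => tp; apply/negP => wM;
  have [/fsubsetP/(_ _ wM) wC] := mov.
by move=> /(_ _ wC); move: tp; case: kind => // _; rewrite wM.
Qed.

Lemma movable_ghost w : ~~ two_parent -> g w = Some u ->
  (w \in M) = (rank h w < rank h u - 2).
Proof.
rewrite /two_parent => tp gw; have [bw _ C] := valid_child V gw.
have wC : w \in children h u.
  by rewrite in_children; move: C tp; rewrite /conn /two_parent; case: kind.
have [_ /(_ _ wC)] := mov; move: tp; case: kind => // _; exact.
Qed.

Lemma split_arcs p w : ((p, w) \in arcs h') =
  if p == x then (w \in M) || two_parent && (w == u)
  else ((p, w) \in arcs h) && ~~ ((p == u) && (w \in M)).
Proof.
have -> : ((p, w) \in arcs h') =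
    ((p, w) \in [fset moved_arc a | a in arcs h]) || two_parent && ((p, w) ==
      (x, u)).
  by rewrite /h' /= inE /two_parent; case: kind; rewrite ?in_fset0 ?in_fset1.
have xN q : (x, q) \notin arcs h.
  by apply: contraNN xh => /(valid_arc V)[].
rewrite xpair_eqE; case: eqVneq => [->|px] /=; last first.
  rewrite andbF orbF; apply/imfsetP/andP => /= [[[q v] qv]|[pw nM]].
    rewrite /moved_arc /=; case: ifP => [_ [E]|nM [-> ->]];
      last by rewrite qv nM.
    by rewrite E eqxx in px.
  by exists (p, w) => //; rewrite /moved_arc /= (negbTE nM).
congr orb; apply/imfsetP/idP => /= [[[q v] qv]|wM].
  rewrite /moved_arc /=; case: ifP => [/andP[_ vM] [->] //|_ [E _]].
  by rewrite -E (negbTE (xN _)) in qv.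
by exists (u, w); [exact: movable_child | rewrite /moved_arc /= eqxx wM].
Qed.

Lemma split_fnd v : (nodes h').[? v] =
  if v == x then Some (Node (item h u) k (rank h u - 2) false)
  else (nodes (update u hollow_out h)).[? v].
Proof. exact: fnd_set. Qed.

Lemma split_dom : dom h' = x |` dom h.
Proof. by rewrite /h' /= -(dom_update u hollow_out h). Qed.

Lemma split_full v : full h' v = (v == x) || (v != u) && full h v.
Proof.
rewrite {1}/full /item split_fnd; case: eqP => // _.
exact: full_update_hollow.
Qed.

Lemma split_rank v : rank h' v = if v == x then rank h u - 2 else rank h v.
Proof.
rewrite {1}/rank split_fnd; case: eqP => // _; exact: rank_update.
Qed.

Lemma split_ranked v : v != x -> ranked h' v = ranked h v.
Proof. by rewrite {1}/ranked split_fnd => /negbTE->; exact: ranked_update. Qed.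

Lemma dom_neq v : v \in dom h -> v == x = false.
Proof. by move=> vh; apply: contraNF xh => /eqP <-. Qed.

Lemma split_valid : valid h' moved_ghost.
Proof.
have uh := full_dom fu.
have neq w o : g w = Some o -> ((w == x) = false) * ((o == x) = false).
  by move=> /(valid_conn_dom V)[oh wh]; rewrite !dom_neq.
split.
- move=> p w; rewrite split_arcs split_dom !inE; case: eqP => [->|_].
    case/orP=> [/movable_child/(valid_arc V)[_ ->]|/andP[_ /eqP->]];
      by rewrite ?uh ?orbT.
  by case/andP => /(valid_arc V)[-> ->]; rewrite !orbT.
- move=> w; apply: (@leq_trans (#|` parents h w| + (two_parent && (w == u)))).
    pose f p := if (p == u) && (w \in M) then x else p.
    pose B := if two_parent && (w == u) then [fset x] else fset0.
    apply: (@leq_trans (#|` [fset f p | p in parents h w] `|` B|)).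
      apply/fsubset_leq_card/fsubsetP => p; rewrite in_parents split_arcs.
      case: eqP => [->|/eqP px].
        case/orP => [wM|tp]; last by rewrite /B tp !inE eqxx orbT.
        apply/fsetUP; left; apply/imfsetP; exists u; last by rewrite /f eqxx wM.
        by rewrite /= in_parents movable_child.
      case/andP => pw nM; apply/fsetUP; left; apply/imfsetP; exists p.
        by rewrite /= in_parents.
      by rewrite /f (negbTE nM).
    apply: leq_trans (leq_card_fsetU _ _) _; apply: leq_add.
      exact: leq_card_fimage.
    by rewrite /B; case: ifP; rewrite ?cardfs1 ?cardfs0.
  rewrite split_full; case: (eqVneq w x) => [->|wx] /=.
    rewrite eq_sym (negbTE split_neq) andbF addn0.
    suff -> : parents h x = fset0 by rewrite cardfs0.
    apply/fsetP => p; rewrite in_parents in_fset0;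
      apply/negP => /(valid_arc V)[_].
    by rewrite (negbTE xh).
  case: (eqVneq w u) => [->|wu]; last by rewrite andbF addn0;
    exact: (valid_parents V).
  by have := valid_parents V u; rewrite fu /= andbT; case: two_parent => /=;
    rewrite ?addn1 ?addn0.
- move=> w o; rewrite /moved_ghost.
  case: ifP => [/andP[/eqP gw rw] [<-]|nm gw].
    have [bw _ C] := valid_child V gw; have [wx _] := neq _ _ gw.
    rewrite split_ranked ?wx // !split_rank eqxx wx; split=> //.
    case: (boolP two_parent) => tp; last first.
      rewrite /conn (negbTE tp) split_arcs eqxx.
      by rewrite (movable_ghost tp gw) rw.
    have xu : (x, u) \in arcs h' by rewrite split_arcs eqxx tp eqxx orbT.
    have sub q v : (q, v) \in arcs h -> (q, v) \in arcs h'.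
      move=> qv; rewrite split_arcs dom_neq; last by have [] := valid_arc V qv.
      by rewrite qv movable_two_parent // andbF.
    move: C; rewrite /conn tp; elim=> [q /sub|p q _ xp /sub];
      last exact: reach_step.
    exact: reach_step (reach_arc xu).
  have [bw rw C] := valid_child V gw; have [wx ox] := neq _ _ gw.
  rewrite split_ranked ?wx // !split_rank wx ox; split=> //.
  case: (boolP two_parent) => tp; last first.
    move: C; rewrite /conn (negbTE tp) split_arcs ox => -> /=.
    apply: contraFN nm => /andP[/eqP ou wM]; subst o.
    by rewrite gw eqxx -movable_ghost.
  apply: conn_sub C; apply/fsubsetP => -[q v] qv.
  rewrite split_arcs dom_neq; last by have [] := valid_arc V qv.
  by rewrite qv movable_two_parent // andbF.
- have spec w o : moved_ghost w = Some o ->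
      [/\ rank h' w = rank h w & o = x /\ g w = Some u \/ o != x /\ g w = Some
        o].
    rewrite /moved_ghost; case: ifP => [/andP[/eqP gw rw] [<-]|_ gw];
      rewrite split_rank (neq _ _ gw); split=> //; first by left.
    by right; rewrite (neq _ _ gw).
  move=> w w' o /spec[-> gw] /spec[-> gw'].
  case: gw gw' => [[ox gw]|[ox gw]] [[ox' gw']|[ox' gw']]; 
    try exact: (valid_inj V gw gw').
    by rewrite ox eqxx in ox'.
  by rewrite ox' eqxx in ox.
- move=> o j; rewrite split_rank split_full.
  case: (eqVneq o x) => [->|ox] /=.
    move=> ju _; have [|w gw rw] := valid_ranks V (leq_trans ju (leq_subr _
      _)); first by rewrite fu.
    exists w; last by rewrite split_rank (neq _ _ gw).
    by rewrite /moved_ghost gw eqxx rw ju.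
  case: (eqVneq o u) => [->|ou] /= jo fo.
    have [|w gw rw] := valid_ranks V jo; first by rewrite fu.
    exists w; last by rewrite split_rank (neq _ _ gw).
    by rewrite /moved_ghost gw rw ltnNge leq_subLR fo andbF.
  have [w gw rw] := valid_ranks V jo fo; exists w;
    last by rewrite split_rank (neq _ _ gw).
  by rewrite /moved_ghost gw (_ : (_ == _) = false) //; apply/eqP => -[/eqP];
    rewrite (negbTE ou).
Qed.

Lemma split_amortized :
  potential h' moved_ghost + split_time kind h u M <= potential h g + A + 17.
Proof.
have uh := full_dom fu.
pose Z := u |` [fset w in dom h |
  [&& full h w, g w == Some u & rank h u - 2 <= rank h w]].
have fZ w : w \in Z -> full h w by rewrite !inE => /orP[/eqP->|/and3P[]].
have cZ : #|` Z| <= 3.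
  rewrite cardfsU1 -(addn1 2) addnC leq_add ?leq_b1 //.
  apply: (@card_leq_interval _ _ (rank h) (rank h u - 2)).
    move=> w w'; rewrite !inE /= => /and4P[_ _ /eqP gw _] /and4P[_ _ /eqP gw'
      _].
    exact: (valid_inj V gw gw').
  move=> w; rewrite !inE /= => /and4P[_ _ /eqP/(valid_child V)[_ rw _] ->].
  by rewrite /=; lia.
have mono w : w \in dom h -> w \notin Z -> shielded h g w ->
    shielded h' moved_ghost w.
  rewrite !inE negb_or /shielded => wh /andP[wu] /=.
  rewrite wh split_full wu /=; case: full => //=; rewrite orbT /moved_ghost.
  case E: (g w) => [o|] //= + fo; case: (eqVneq o u) => [->|ou]; last first.
    rewrite (_ : (Some o == _) = false) /= ?split_full ?ou ?fo ?orbT //.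
    by apply/eqP => -[/eqP]; rewrite (negbTE ou).
  by rewrite eqxx /= -ltnNge => -> /=; rewrite split_full eqxx.
pose cut (a : nat * nat) : bool := [&& ~~ two_parent, a.1 == u & a.2 \notin M].
have tm : split_time kind h u M <= 1 + \sum_(a <- arcs h) cut a.
  rewrite -card_fset_sum; set n := #|` _|.
  have : ~~ two_parent -> #|` children h u `\` M| <= n.
    move=> tp; apply: leq_trans (leq_card_fimage snd _).
    apply/fsubset_leq_card/fsubsetP => w;
      rewrite in_fsetD in_children => /andP[wM uw].
    by apply/imfsetP; exists (u, w) => //; rewrite !inE uw /cut tp eqxx.
  by rewrite /split_time /two_parent; case: kind => // [] /(_ isT);
    rewrite leq_add2l.
have arcle : \sum_(a <- arcs h) (arc_weight h' moved_ghost (moved_arc a) + cut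
  a)
    <= \sum_(a <- arcs h) (arc_weight h g a + 2 * (a.2 \in Z)).
  apply: leq_sum_fset => -[p w] pw.
  have [ph wh] := valid_arc V pw; have := mono w wh.
  have px := dom_neq ph.
  have E2 : (moved_arc (p, w)).2 = w by rewrite /moved_arc; case: ifP.
  have F1 : cut (p, w) -> full h' (moved_arc (p, w)).1 = false.
    rewrite /cut /moved_arc /= => /and3P[_ /eqP-> /negbTE->].
    by rewrite andbF split_full eqxx (negbTE split_neq).
  have F2 : full h' (moved_arc (p, w)).1 <= full h p.
    rewrite /moved_arc /=; case: ifP => [/andP[/eqP-> _]|_];
      first by rewrite fu leq_b1.
    by rewrite split_full /= px; case: (p != u).
  have F3 : cut (p, w) -> full h p by rewrite /cut /= => /and3P[_ /eqP->].
  case: (boolP (w \in Z)) => [_ _|wZ /(_ isT) sw] /=.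
    apply: (@leq_trans 2); last by lia.
    rewrite /arc_weight; case C: (cut _); first by rewrite (F1 C);
      case: shielded.
    by rewrite addn0; case: shielded; case: full.
  rewrite addn0 /arc_weight E2 /=;
    case: (boolP (shielded h g w)) sw => [S /(_ isT)->|_ _] /=.
    rewrite !mul0n add0n; case: (boolP (cut _)) => // /and3P[tp /= /eqP pu wM];
      subst p.
    move: S wZ; rewrite /shielded => /andP[fw]; case gw: (g w) => [o|] //= fo.
    have [_ _] := valid_child V gw; rewrite /conn (negbTE tp) => ow.
    have ou : o = u by apply: unique_parent V _ ow pw; rewrite fw.
    subst o; rewrite !inE negb_or /= wh fw gw eqxx /= -ltnNge => /andP[_].
    by rewrite -movable_ghost // (negbTE wM).
  move: F1 F2 F3; case: (cut _) => [/(_ isT)-> _ /(_ isT)->|_ + _];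
    first by case: shielded.
  by rewrite mul1n; case: shielded => //=; rewrite mul1n addn0.
have arcle' : \sum_(a <- arcs h') arc_weight h' moved_ghost a <=
    \sum_(a <- arcs h) arc_weight h' moved_ghost (moved_arc a) + 2.
  apply: leq_trans (leq_sum_fsetU _ _ _) _; apply: leq_add.
    exact: leq_sum_imfset.
  case: kind; rewrite ?big_seq_fset0 ?big_seq_fset1 //; exact: arc_weight_le2.
have := arcs_into_bound V fZ; have := unshielded_bound mono.
move: arcle; rewrite 2!big_split -(big_distrr 2) /=.
move: arcle'; rewrite /potential /num_nodes split_dom; 
set W := \sum_(a <- arcs h') arc_weight h' moved_ghost a.
rewrite big_fsetU1 //= (cardfsU1 x (dom h)) xh /=.
move: cZ tm; move: #|` Z| (\sum_(a <- arcs h) cut a) W => z C W.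
by case: (shielded h' _ x) => /=; lia.
Qed.

End SplitNode.


Lemma join_amortized h g a b h' : valid h g ->
  kind = MultiRoot \/ [/\ a \in root_nodes h, b \in root_nodes h, a != b,
                          full h a & full h b] ->
  join kind h a b h' ->
  [/\ valid h' g, minp_root h', dom h' = dom h &
      potential h' g <= potential h g + 2].
Proof.
move=> V ab; suff J u v : kind = MultiRoot \/ [/\ u \in root_nodes h,
    v \in root_nodes h, u != v, full h u & full h v] ->
  [/\ valid (joined kind h u v) g, minp_root (joined kind h u v),
      dom (joined kind h u v) = dom h &
      potential (joined kind h u v) g <= potential h g + 2].
  case=> _; apply: J => //.
  by case: ab => [|[aR bR nab fa fb]]; [left | right; rewrite eq_sym].
move=> {a b ab h'} uv; rewrite /joined;
  set h' := if kind is MultiRoot then _ else _.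
suff [V' M' d' p'] : [/\ valid h' g,
    kind = MultiRoot \/ u \in root_nodes h' /\ full h' u, dom h' = dom h &
    potential h' g <= potential h g + 2].
  split=> //; first exact: valid_set_minp.
  by case: M' => M'; [left | right=> _ /= [<-]].
case: uv => [E|[uR vR nuv fu fv]].
  by rewrite /h' E; split; rewrite ?leq_addr //; left.
have [V' d' f' r' p'] := link_arc_amortized V uR vR fu fv.
have L : [/\ valid (link_arc false u v h) g,
    kind = MultiRoot \/ u \in root_nodes (link_arc false u v h) /\
      full (link_arc false u v h) u, dom (link_arc false u v h) = dom h &
    potential (link_arc false u v h) g <= potential h g + 2].
  by split=> //; right; rewrite r' f' in_fsetD1 nuv uR.
by move: L; rewrite /h'; case: kind => // _; split; rewrite ?leq_addr //; left.
Qed.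

Lemma decrease_key_amortized h g u x k t h' : valid h g -> minp_root h ->
  full h u -> x \notin dom h -> decrease_key kind h u x k t h' ->
  exists g', [/\ valid h' g', minp_root h', dom h' `<=` x |` dom h &
    potential h' g' + t <= potential h g + A + 20].
Proof.
move=> V M fu xh; case=> [m {}h' uR mm h1 E|m S {}h' uR mm mov J].
  have Ef : full h1 =1 full h by move=> v; exact: full_update.
  have Ea : arcs h1 = arcs h by exact: arcs_update.
  have Ed : dom h1 = dom h by exact: dom_update.
  have [V1 p1] : valid h1 g /\ potential h1 g = potential h g.
    by apply: valid_ext V => // v; [exact: rank_update | exact: ranked_update].
  have Er : root_nodes h1 = root_nodes h.
    by apply/fsetP => v; apply/rootP/rootP; rewrite Ea Ed.
  have [z -> Mz] : exists2 z, h' = set_minp (Some z) h1 &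
      kind = MultiRoot \/ z \in root_nodes h1 /\ full h1 z.
    case: E => -[_ ->]; [exists u | exists m] => //; rewrite Er Ef;
      first by right.
    by case: M => M; [left | right; exact: M].
  exists g; split.
  - exact: valid_set_minp.
  - by case: Mz => Mz; [left | right=> _ /= [<-]].
  - by rewrite /= Ed fsubsetUr.
  - by rewrite (@potential_eq h1) //; lia.
have V1 := split_valid k V fu xh mov.
have p1 := split_amortized k V fu xh mov.
have {J} [|V2 M2 d2 p2] := join_amortized V1 _ J.
  case: M => [|/(_ _ mm)[mR fm]]; first by left.
  case: uR => [uR|]; last by left.
  have mu : m != u by apply: contraNneq uR => <-.
  have mx : m == x = false by apply: dom_neq xh _ (full_dom fm).
  right; split; [| |by rewrite eq_sym mx|by rewrite split_full // eqxx|by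
    rewrite split_full // mu fm orbT].
    apply/rootP; rewrite split_dom !inE eqxx; split=> // p.
    rewrite (split_arcs k V xh mov) (eq_sym x u) (negbTE (split_neq fu xh))
      andbF orbF.
    have xN q : (q, x) \notin arcs h by apply: contraNN xh => /(valid_arc V)[].
    case: eqP => _; last by rewrite (negbTE (xN p)).
    by apply/negP => /(movable_child mov); rewrite (negbTE (xN u)).
  have [mh pm] := rootP _ _ mR.
  apply/rootP; rewrite split_dom !inE mh orbT; split=> // p.
  rewrite (split_arcs k V xh mov) (negbTE mu) andbF orbF.
  case: eqP => _; last by rewrite (negbTE (pm p)).
  by apply/negP => /(movable_child mov); rewrite (negbTE (pm u)).
exists (moved_ghost h g u x); split=> //; first by rewrite d2 split_dom.
lia.
Qed.

(** * Meld *)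

Section Union.
Variables (h1 h2 : heap) (g1 g2 : nat -> option nat).
Hypotheses (V1 : valid h1 g1) (V2 : valid h2 g2)
  (dis : [disjoint dom h1 & dom h2]).
Let h := Heap (nodes h1 + nodes h2)%fset (arcs h1 `|` arcs h2) None.

Definition union_ghost w : option nat := if w \in dom h1 then g1 w else g2 w.

Lemma union_fnd w : (nodes h).[? w] =
  if w \in dom h1 then (nodes h1).[? w] else (nodes h2).[? w].
Proof.
rewrite /= fnd_cat; case: ifPn => wh2; last first.
  case: ifPn => // wh1; rewrite !not_fnd //.
by rewrite (negbTE (fdisjointP_sym dis _ wh2)).
Qed.

Lemma union_full w : full h w = if w \in dom h1 then full h1 w else full h2 w.
Proof. by rewrite /full /item union_fnd; case: ifP. Qed.

Lemma union_rank w : rank h w = if w \in dom h1 then rank h1 w else rank h2 w.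
Proof. by rewrite /rank union_fnd; case: ifP. Qed.

Lemma union_ranked w :
  ranked h w = if w \in dom h1 then ranked h1 w else ranked h2 w.
Proof. by rewrite /ranked union_fnd; case: ifP. Qed.

Lemma union_arcs p w : ((p, w) \in arcs h) =
  if w \in dom h1 then (p, w) \in arcs h1 else (p, w) \in arcs h2.
Proof.
rewrite inE; case: ifPn => wh.
  rewrite orbC; case: (boolP (_ \in arcs h2)) => // /(valid_arc V2)[_ wh2].
  by rewrite (negbTE (fdisjointP dis _ wh)) in wh2.
by case: (boolP (_ \in arcs h1)) => // /(valid_arc V1)[_]; rewrite (negbTE wh).
Qed.

Lemma union_ghost_dom w o : union_ghost w = Some o ->
  [/\ w \in dom h1, o \in dom h1 & g1 w = Some o] \/
  [/\ w \notin dom h1, o \notin dom h1 & g2 w = Some o].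
Proof.
rewrite /union_ghost; case: ifPn => [_ gw|wh gw].
  by left; have [] := valid_conn_dom V1 gw.
by right; split=> //; have [/(fdisjointP_sym dis)] := valid_conn_dom V2 gw.
Qed.

Lemma union_dom : dom h = dom h1 `|` dom h2.
Proof. exact: domf_cat. Qed.

Lemma union_root a : a \in root_nodes h1 \/ a \in root_nodes h2 ->
  a \in root_nodes h.
Proof.
by case=> /rootP[ah pa]; apply/rootP; rewrite union_dom inE ah ?orbT;
  split=> // p;
  rewrite union_arcs ?ah ?(negbTE (fdisjointP_sym dis _ ah)).
Qed.

Lemma union_valid : valid h union_ghost.
Proof.
split.
- move=> p w; rewrite union_dom !inE => /orP[/(valid_arc V1)|/(valid_arc V2)]
    [-> ->];
  by rewrite ?orbT.
- move=> w; rewrite union_full;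
    have := (valid_parents V1 w, valid_parents V2 w).
  have -> : parents h w = if w \in dom h1 then parents h1 w else parents h2 w.
    by apply/fsetP => p; rewrite in_parents union_arcs; case: ifP;
      rewrite in_parents.
  by case: (w \in dom h1) => -[].
- move=> w o /union_ghost_dom[[wh oh gw]|[/negbTE wh /negbTE oh gw]];
    rewrite !union_rank union_ranked wh oh.
    have [? ? C] := valid_child V1 gw; split=> //; apply: conn_sub C;
      exact: fsubsetUl.
  have [? ? C] := valid_child V2 gw; split=> //; apply: conn_sub C;
    exact: fsubsetUr.
- move=> w w' o /union_ghost_dom[[wh oh gw]|[/negbTE wh /negbTE oh gw]]
    /union_ghost_dom[[wh' oh' gw']|[/negbTE wh' /negbTE oh' gw']];
    rewrite !union_rank wh wh' => rww.
  + exact: (valid_inj V1 gw gw').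
  + by rewrite oh in oh'.
  + by rewrite oh' in oh.
  + exact: (valid_inj V2 gw gw').
- move=> o j; rewrite union_rank union_full; case: ifPn => oh jo fo.
    have [w gw rw] := valid_ranks V1 jo fo; have [_ wh] := valid_conn_dom V1 gw.
    by exists w; rewrite ?/union_ghost ?union_rank wh.
  have [w gw rw] := valid_ranks V2 jo fo; have [_ wh] := valid_conn_dom V2 gw.
  by exists w; rewrite ?/union_ghost ?union_rank (negbTE (fdisjointP_sym dis _
    wh)).
Qed.

Lemma union_potential :
  potential h union_ghost <= potential h1 g1 + potential h2 g2.
Proof.
have F1 w : w \in dom h1 -> full h w = full h1 w by rewrite union_full => ->.
have F2 w : w \in dom h2 -> full h w = full h2 w.
  by move=> /(fdisjointP_sym dis)/negbTE wh; rewrite union_full wh.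
have S1 w : w \in dom h1 -> shielded h union_ghost w = shielded h1 g1 w.
  move=> wh; rewrite /shielded /union_ghost wh F1 //;
    case gw: (g1 w) => [o|] //=.
  by have [/F1 -> _] := valid_conn_dom V1 gw.
have S2 w : w \in dom h2 -> shielded h union_ghost w = shielded h2 g2 w.
  move=> wh; rewrite /shielded /union_ghost (negbTE (fdisjointP_sym dis _ wh))
    F2 //.
  by case gw: (g2 w) => [o|] //=; have [/F2 -> _] := valid_conn_dom V2 gw.
rewrite /potential /num_nodes union_dom.
have := leq_card_fsetU (dom h1) (dom h2).
have := leq_sum_fsetU (dom h1) (dom h2) (fun w => ~~ shielded h union_ghost w).
have := leq_sum_fsetU (arcs h1) (arcs h2) (arc_weight h union_ghost).
have -> : \sum_(i <- arcs h1) arc_weight h union_ghost i =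
    \sum_(i <- arcs h1) arc_weight h1 g1 i.
  rewrite big_seq [RHS]big_seq; apply: eq_bigr => -[p w] /(valid_arc V1)[ph wh].
  by rewrite /arc_weight /= S1 // F1.
have -> : \sum_(i <- arcs h2) arc_weight h union_ghost i =
    \sum_(i <- arcs h2) arc_weight h2 g2 i.
  rewrite big_seq [RHS]big_seq; apply: eq_bigr => -[p w] /(valid_arc V2)[ph wh].
  by rewrite /arc_weight /= S2 // F2.
have -> : \sum_(i <- dom h1) ~~ shielded h union_ghost i = \sum_(i <- dom h1)
  ~~ shielded h1 g1 i.
  by rewrite big_seq [RHS]big_seq; apply: eq_bigr => w /S1 ->.
have -> : \sum_(i <- dom h2) ~~ shielded h union_ghost i = \sum_(i <- dom h2)
  ~~ shielded h2 g2 i.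
  by rewrite big_seq [RHS]big_seq; apply: eq_bigr => w /S2 ->.
move: (\sum_(i <- dom h1 `|` dom h2) _) (\sum_(i <- arcs h1 `|` arcs h2) _).
move=> a b hb ha hc.
have := leq_mul (leqnn A) hc; rewrite mulnDr; lia.
Qed.

End Union.

Lemma meld_amortized h1 h2 g1 g2 h' : valid h1 g1 -> valid h2 g2 ->
  minp_root h1 -> minp_root h2 -> [disjoint dom h1 & dom h2] ->
  meld kind h1 h2 h' ->
  exists g', [/\ valid h' g', minp_root h', dom h' `<=` dom h1 `|` dom h2 &
    potential h' g' <= potential h1 g1 + potential h2 g2 + 2].
Proof.
move=> V1 V2 M1 M2 dis me; case: me V1 V2 M1 M2 dis =>
  [{}h1 {}h2 _|{}h1 {}h2 _|{}h1 {}h2 a b {}h' ma mb J] V1 V2 M1 M2 dis.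
- by exists g2; split=> //; [exact: fsubsetUr | lia].
- by exists g1; split=> //; [exact: fsubsetUl | lia].
have [|V M d p] := join_amortized (union_valid V1 V2 dis) _ J.
  case: M1 => [|/(_ _ ma)[aR fa]]; first by left.
  case: M2 => [|/(_ _ mb)[bR fb]]; first by left.
  have [ah bh] := (full_dom fa, full_dom fb).
  have bh1 := fdisjointP_sym dis _ bh.
  right; rewrite !union_full // ah (negbTE bh1); split=> //.
  - by apply: (union_root V1 V2) => //; left.
  - by apply: (union_root V1 V2) => //; right.
  - by apply: contraNneq bh1 => <-.
exists (union_ghost h1 g1 g2); split=> //; first by rewrite d union_dom.
by have := union_potential V1 V2 dis; lia.
Qed.


(** * Rebuilding *)

Lemma in_rebuilt_dom h w : (w \in domf (reset_full_nodes h)) = full h w.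
Proof.
change ((w \in domf (nodes h).[& full_nodes h]) = full h w).
rewrite domf_restrict inE in_full_nodes.
by case: (boolP (full h w)) => //= /full_dom.
Qed.

Lemma reset_full_nodes_fnd h w : full h w ->
  (reset_full_nodes h).[? w] = omap reset_rank (nodes h).[? w].
Proof.
move=> fw; have wD : w \in domf (reset_full_nodes h) by rewrite in_rebuilt_dom.
have -> : (nodes h).[? w] = (nodes h).[& full_nodes h].[? w].
  by rewrite fnd_restrict in_full_nodes fw.
by rewrite (in_fnd wD) (in_fnd (wD : w \in domf _.[& _])) /= ffunE /=;
  do 2 congr Some; exact: eq_getf.
Qed.

Section Rebuilt.
Variables (h : heap) (E : {fset nat * nat}).
Hypotheses (Ef : forall p w, (p, w) \in E -> full h p /\ full h w)
  (Ep : forall p q w, (p, w) \in E -> (q, w) \in E -> p = q).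
Let h' := Heap (reset_full_nodes h) E None.

Lemma rebuilt_dom : dom h' = full_nodes h.
Proof. by apply/fsetP => w; rewrite in_rebuilt_dom in_full_nodes. Qed.

Lemma rebuilt_full w : full h' w = full h w.
Proof.
apply/idP/idP => [/full_dom|fw]; first by rewrite in_rebuilt_dom.
rewrite /full /item /= reset_full_nodes_fnd //.
by move: fw; rewrite /full /item; case: (nodes h).[? w].
Qed.

Lemma rebuilt_rank w : rank h' w = 0.
Proof.
rewrite /rank; case: fndP => // wD.
have fw : full h w by rewrite -in_rebuilt_dom.
move: (in_fnd wD); rewrite /= reset_full_nodes_fnd //.
by case: (nodes h).[? w] => //= nd [<-].
Qed.

Lemma rebuilt_valid : valid h' (fun => None).
Proof.
split=> //.
- by move=> p w /Ef[fp fw]; rewrite rebuilt_dom !in_full_nodes.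
- move=> w; apply: (@leq_trans 1); last by case: ifP.
  case: (fset_0Vmem (parents h' w)) => [->|[p]]; first by rewrite cardfs0.
  rewrite in_parents => pw; rewrite -(cardfs1 p);
    apply/fsubset_leq_card/fsubsetP => q.
  by rewrite in_parents inE => qw; apply/eqP; exact: Ep qw pw.
- by move=> o j; rewrite rebuilt_rank.
Qed.

Lemma rebuilt_arcs_card : #|` E| <= num_items h.
Proof.
rewrite -(@card_in_fimage _ _ E snd); last first.
  by move=> [p w] [q v] /= pw qv wv; subst v; rewrite (Ep pw qv).
apply/fsubset_leq_card/fsubsetP => _ /imfsetP[[p w] /= /Ef[_ fw] ->].
by rewrite in_full_nodes.
Qed.

Lemma rebuilt_potential g :
  potential h' g <= A * num_items h + 2 * num_items h + 2 * #|` E|.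
Proof.
rewrite /potential /num_nodes rebuilt_dom.
apply: leq_add; first (apply: leq_add => //; rewrite leq_mul2l /=).
  by rewrite /num_items card_fset_sum1; apply: leq_sum_fset => w _;
    case: shielded.
rewrite card_fset_sum1 big_distrr /=; apply: leq_sum_fset => a _;
  exact: arc_weight_le2.
Qed.

End Rebuilt.

Lemma nearest_full_ancestor_inj h p q w :
  (forall a b v, (a, v) \in arcs h -> (b, v) \in arcs h -> a = b) ->
  nearest_full_ancestor h p w -> nearest_full_ancestor h q w -> p = q.
Proof.
move=> up np; elim: np q => [{}w pw fp|u {}w uw hu _ IH] q nq.
  case: nq pw => [{}w qw _ pw|u {}w uw /andP[_ hu] _ pw]; first exact: up pw qw.
  by rewrite -(up _ _ _ pw uw) fp in hu.
case: nq uw => [{}w qw fq uw|u' {}w u'w hu' nq uw].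
  by move: hu; rewrite (up _ _ _ uw qw) /hollow fq andbF.
by apply: IH; rewrite (up _ _ _ uw u'w).
Qed.

Lemma nearest_full_ancestor_full h p w : nearest_full_ancestor h p w -> full h
  p.
Proof. by elim. Qed.

Lemma rebuild_amortized h t h' : rebuild kind h t h' ->
  exists g', [/\ valid h' g', minp_root h', dom h' = full_nodes h,
    num_items h' = num_items h &
    potential h' g' + t <= A * num_items h + 6 * num_nodes h].
Proof.
have nN : num_items h <= num_nodes h.
  by apply/fsubset_leq_card/fsubsetP => w; rewrite in_full_nodes;
    exact: full_dom.
have fin h1 h2 g : valid h1 g -> record_min h1 h2 -> dom h1 = full_nodes h ->
    full h1 =1 full h -> [/\ valid h2 g, minp_root h2, dom h2 = full_nodes h,
      num_items h2 = num_items h & potential h2 g = potential h1 g].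
  move=> V rm D F; have [V2 M2 En Ea] := record_min_valid V rm.
  split=> //; [by rewrite En | | exact: potential_eq].
  congr (#|` _|); apply/fsetP => w; rewrite !in_full_nodes -F.
  by rewrite /full /item En.
case=> [{}t h1 {}h' un rm|h1 E {}h' [En Ea Ep] EP rm].
  have ne p w : (p, w) \in (fset0 : {fset nat * nat}) -> full h p /\ full h w
    by [].
  have V := @rebuilt_valid h fset0 ne (fun p q w (i : (p, w) \in fset0) _ =>
    match notF i with end).
  have [V1 p1 d1 t1 f1] := unify_amortized V un.
  exists (fun => None); have [||V2 M2 d2 n2 p2] := fin _ _ _ V1 rm.
  - by rewrite d1 rebuilt_dom.
  - by move=> w; rewrite f1 rebuilt_full.
  split=> //; rewrite p2.
  have p0 := @rebuilt_potential h fset0 (fun => None); rewrite cardfs0 in p0.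
  have t2 : t <= num_items h.
    apply: leq_trans t1 _; apply/fsubset_leq_card/fsubsetP => w /rootP[].
    by rewrite rebuilt_dom.
  lia.
have fE w : full h1 w = full h w by rewrite /full /item En.
have up a b v : (a, v) \in arcs h1 -> (b, v) \in arcs h1 -> a = b.
  by rewrite -!in_parents; apply: eq_of_card_le1; rewrite Ep geq_minl.
have eF p w : (p, w) \in E -> full h p /\ full h w.
  by move/EP=> [fw /nearest_full_ancestor_full]; rewrite fE.
have eP p q w : (p, w) \in E -> (q, w) \in E -> p = q.
  move=> /EP[_ pw] /EP[_ qw]; exact: nearest_full_ancestor_inj up pw qw.
have V := rebuilt_valid eF eP.
exists (fun => None); have [||V2 M2 d2 n2 p2] := fin _ _ _ V rm.
- by rewrite rebuilt_dom.
- by move=> w; rewrite rebuilt_full.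
split=> //; rewrite p2.
have p0 := @rebuilt_potential h E (fun => None).
by have := rebuilt_arcs_card eF eP; lia.
Qed.

(* The condition on [A] makes [A (N - n)] at least [6 N] when [N > c n]. *)
Section Rebuilding.
Variables (R : realType) (c : R).
Hypotheses (c1 : (1 < c)%R) (cA : (6%:R * c <= A%:R * (c - 1))%R).

Lemma maintain_amortized h g t h' : valid h g -> minp_root h ->
  maintain kind c h t h' ->
  exists g', [/\ valid h' g', minp_root h', dom h' `<=` dom h,
    ~~ too_large c h' & potential h' g' + t <= potential h g].
Proof.
move=> V M [small|{}t {}h' large rb]; first by exists g; rewrite addn0.
have [g' [V' M' d' n' p']] := rebuild_amortized rb.
exists g'; split=> //.
- by rewrite d'; apply/fsubsetP => w; rewrite in_full_nodes; exact: full_dom.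
- rewrite /too_large n' /num_nodes d' -/(num_items h) -leNgt.
  by rewrite ler_peMl // ltW.
apply: leq_trans p' _; apply: (@leq_trans (A * num_nodes h));
  last by rewrite /potential -addnA leq_addr.
have c0 : (0 < c)%R by exact: lt_trans c1.
rewrite -(ler_nat R) -(ler_pM2l c0) natrD !natrM.
have A0 : (0 <= A%:R :> R)%R by exact: ler0n.
have N0 : (0 <= (num_nodes h)%:R :> R)%R by exact: ler0n.
have := ler_wpM2l A0 (ltW large); have := ler_wpM2r N0 cA.
by nra.
Qed.



(** * Sequences of operations *)

Definition heap_ok h b : Prop := exists g,
  [/\ valid h g, minp_root h, ~~ too_large c h & potential h g <= b].

Lemma num_nodes_le k h : (c <= (2 ^ k)%:R)%R -> ~~ too_large c h ->
  num_nodes h <= 2 ^ k * num_items h.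
Proof.
move=> ck; rewrite /too_large -leNgt => Nn; rewrite -(ler_nat R) natrM.
by apply: le_trans Nn _; apply: ler_wpM2r.
Qed.

Lemma log_num_nodes k h : (c <= (2 ^ k)%:R)%R -> ~~ too_large c h ->
  (trunc_log 2 (num_nodes h)).+1 <= k.+1 * (trunc_log 2 (num_items h)).+1.
Proof.
move=> ck sm; have Nn := num_nodes_le ck sm.
case: (posnP (num_nodes h)) => [->|N0]; first by rewrite trunc_log0 muln_gt0.
have lt : 2 ^ trunc_log 2 (num_nodes h) < 2 ^ (k + (trunc_log 2 (num_items
  h)).+1).
  apply: leq_ltn_trans (trunc_logP _ N0) _ => //; apply: leq_ltn_trans Nn _.
  by rewrite expnD ltn_pmul2l ?expn_gt0 // trunc_log_ltn.
by move: lt; rewrite ltn_exp2l //; lia.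
Qed.

Lemma space_bound h g : valid h g -> heap_space h <= 3 * num_nodes h.
Proof.
move=> V; rewrite /heap_space mulSn leq_add2l mulnC.
rewrite card_fset_sum1 (partition_big_imfset _ snd) /=.
apply: (@leq_trans (\sum_(w <- [fset a.2 | a in arcs h]) 2)).
  apply: leq_sum_fset => w _; apply: (@leq_trans #|` parents h w|); last first.
    by apply: leq_trans (valid_parents V w) _; case: ifP.
  rewrite (_ : parents h w = [fset a.1 | a in [fset a in arcs h | a.2 == w]]);
    last first.
    by apply: eq_imfset => // a; rewrite !inE.
  rewrite card_in_fimage; last first.
    move=> [p v] [q v']; rewrite !inE /= => /andP[_ /eqP->] /andP[_ /eqP->].
    by move=> ->.
  by rewrite card_fset_sum big_mkcond /=; apply: leq_sum => a _; case: ifP.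
have -> (X : {fset nat}) : \sum_(w <- X) 2 = #|` X| * 2.
  by rewrite card_fset_sum1 big_distrl.
rewrite leq_mul2r /=; apply/fsubset_leq_card/fsubsetP.
by move=> _ /imfsetP[[p w] /= /(valid_arc V)[_ wh] ->].
Qed.

Definition state_ok (s : state Key Item) (P : nat) : Prop := exists f : nat ->
  nat,
  [/\ forall i h, s.[? i] = Some h -> heap_ok h (f i),
      forall i j hi hj, i != j -> s.[? i] = Some hi -> s.[? j] = Some hj ->
        [disjoint dom hi & dom hj]
    & \sum_(i <- domf s) f i <= P].

Lemma state_ok_set s P i h h' (X : {fset nat}) t d : state_ok s P ->
  s.[? i] = Some h -> (forall x, x \in X -> fresh_node s x) ->
  (forall b, heap_ok h b ->
    exists b', [/\ heap_ok h' b', dom h' `<=` X `|` dom h & b' + t <= b + d]) ->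
  exists2 P', state_ok s.[i <- h'] P' & P' + t <= P + d.
Proof.
move=> [f [ok dis sP]] si fX step.
have is_ : i \in domf s by rewrite -fndSome si.
have [b' [ok' d' le']] := step _ (ok _ _ si).
pose f' k := if k == i then b' else f k.
exists (b' + \sum_(k <- domf s `\ i) f k); last first.
  by move: sP; rewrite (big_fsetD1 i is_) /=; lia.
exists f'; split.
- move=> k hk; rewrite fnd_set /f'; case: eqP => [_ [<-]|_] //; exact: ok.
- have D k hk : k != i -> s.[? k] = Some hk -> [disjoint dom h' & dom hk].
    move=> ki sk; apply: fdisjointWl d' _; rewrite fdisjointUX; apply/andP;
      split.
      by apply/fdisjointP => x /fX/(_ _ _ sk).
    by apply: dis si sk; rewrite eq_sym.
  move=> k l hk hl kl; rewrite !fnd_set.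
  case: (eqVneq k i) => ki; case: (eqVneq l i) => li.
  + by rewrite ki li eqxx in kl.
  + by move=> [<-]; exact: D.
  + by move=> sk [<-]; rewrite fdisjoint_sym; exact: D ki sk.
  + exact: dis.
rewrite (_ : domf _ = domf s); last first.
  by apply/fsetP => k; rewrite dom_setf !inE; case: eqP => // ->.
rewrite (big_fsetD1 i is_) /= /f' eqxx leq_add2l.
by apply: leq_sum_fset => k; rewrite !inE => /andP[/negbTE->].
Qed.

Lemma heap_ok_empty : heap_ok empty_heap 0.
Proof.
have V : valid empty_heap (fun => None).
  split=> //; last by move=> o j; rewrite /rank fnd_fmap0.
  by move=> w; rewrite (_ : parents _ w = fset0) ?cardfs0 //; apply/fsetP => p;
    rewrite in_parents.
exists (fun => None); split=> //; first by right.
  rewrite /too_large /num_nodes /num_items.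
  rewrite (_ : dom _ = fset0) // (_ : full_nodes _ = fset0); last first.
    by apply/fsetP => w; rewrite in_full_nodes /full /item fnd_fmap0.
  by rewrite cardfs0 mulr0 ltxx.
rewrite /potential /num_nodes (_ : dom _ = fset0) // (_ : arcs _ = fset0) //.
by rewrite !big_seq_fset0 cardfs0 muln0.
Qed.

Lemma one_node_valid x (e : Item) (k : Key) :
  [/\ valid (one_node x e k) (fun => None), minp_root (one_node x e k),
      dom (one_node x e k) = [fset x] &
      potential (one_node x e k) (fun => None) <= A + 2].
Proof.
have D : dom (one_node x e k) = [fset x].
  by rewrite -[RHS]fsetU0; exact: dom_setf.
have F : full (one_node x e k) x by rewrite /full /item /= fnd_set eqxx.
split=> //.
- split=> //; last by move=> o j; rewrite /rank fnd_set; case: eqP;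
    rewrite ?fnd_fmap0.
  by move=> w; rewrite (_ : parents _ w = fset0) ?cardfs0 //; apply/fsetP => p;
    rewrite in_parents.
- right=> m /= [<-]; split=> //; apply/rootP; rewrite D inE eqxx; split=> //.
rewrite /potential /num_nodes D cardfs1 muln1 big_seq_fset1 big_seq_fset0 addn0
  leq_add2l.
by case: shielded.
Qed.

Lemma insert_amortized s P i h (e : Item) (k : Key) x h1 t h2 : state_ok s P ->
  s.[? i] = Some h -> fresh_node s x -> meld kind h (one_node x e k) h1 ->
  maintain kind c h1 t h2 ->
  exists2 P', state_ok s.[i <- h2] P' & P' + (2 + t) <= P + (A + 6).
Proof.
move=> S si fx me ma;
  apply: (state_ok_set (X := [fset x]) S si) => [y /fset1P->//|b [g [V M sm
  p]]].
have [V1 M1 D1 p1] := one_node_valid x e k.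
have dis : [disjoint dom h & dom (one_node x e k)].
  by rewrite D1 fdisjointX1; exact: fx si.
have [g2 [V2 M2 d2 p2]] := meld_amortized V V1 M M1 dis me.
have [g3 [V3 M3 d3 sm3 p3]] := maintain_amortized V2 M2 ma.
exists (potential h2 g3); split; [by exists g3 | | by lia].
by apply: fsubset_trans d3 _; apply: fsubset_trans d2 _; rewrite D1 fsetUC.
Qed.

Lemma delete_amortized k s P i h (e : Item) u t1 h1 t2 h2 :
  (c <= (2 ^ k)%:R)%R -> state_ok s P ->
  s.[? i] = Some h -> item h u = Some e -> delete_node kind h u t1 h1 ->
  maintain kind c h1 t2 h2 ->
  exists2 P', state_ok s.[i <- h2] P' &
    P' + (t1 + t2) <= P + 18 * (k.+1 * (trunc_log 2 (num_items h)).+1).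
Proof.
move=> ck S si ue de ma;
  apply: (state_ok_set (X := fset0) S si) => // b [g [V M sm p]].
have fu : full h u by rewrite /full ue.
have [g1 [V1 M1 d1 p1]] := delete_node_amortized V M fu de.
have [g2 [V2 M2 d2 sm2 p2]] := maintain_amortized V1 M1 ma.
exists (potential h2 g2); split; first by exists g2.
  by rewrite fset0U; exact: fsubset_trans d2 d1.
have := log_num_nodes ck sm; lia.
Qed.

Lemma decrease_amortized s P i h (e : Item) k u nd x t1 h1 t2 h2 :
  state_ok s P -> s.[? i] = Some h -> (nodes h).[? u] = Some nd ->
  nd_item nd = Some e -> fresh_node s x -> decrease_key kind h u x k t1 h1 ->
  maintain kind c h1 t2 h2 ->
  exists2 P', state_ok s.[i <- h2] P' & P' + (t1 + t2) <= P + (A + 20).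
Proof.
move=> S si un ue fx de ma.
apply: (state_ok_set (X := [fset x]) S si) => [y /fset1P->//|b [g [V M sm p]]].
have fu : full h u by rewrite /full /item un /= ue.
have [g1 [V1 M1 d1 p1]] := decrease_key_amortized V M fu (fx _ _ si) de.
have [g2 [V2 M2 d2 sm2 p2]] := maintain_amortized V1 M1 ma.
exists (potential h2 g2); split;
  [by exists g2 | exact: fsubset_trans d2 d1 | by lia].
Qed.

Lemma make_heap_amortized s P i : state_ok s P -> i \notin domf s ->
  state_ok s.[i <- empty_heap] P.
Proof.
move=> [f [ok dis sP]] is_; exists (fun k => if k == i then 0 else f k); split.
- by move=> k hk; rewrite fnd_set; case: eqP => [_ [<-]|_];
    [exact: heap_ok_empty | exact: ok].
- move=> k l hk hl kl; rewrite !fnd_set.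
  case: (eqVneq k i) => ki; case: (eqVneq l i) => li.
  + by rewrite ki li eqxx in kl.
  + by move=> [<-] _; exact: fdisjoint0X.
  + by move=> _ [<-]; exact: fdisjointX0.
  + exact: dis.
rewrite dom_setf big_fsetU1 //= eqxx add0n; apply: leq_trans sP.
by apply: leq_sum_fset => k ks; case: ifP.
Qed.

Lemma meld_state_amortized s P i j h1 h2 h3 t h4 : state_ok s P -> i != j ->
  s.[? i] = Some h1 -> s.[? j] = Some h2 -> meld kind h1 h2 h3 ->
  maintain kind c h3 t h4 ->
  exists2 P', state_ok s.[~ j].[i <- h4] P' & P' + (1 + t) <= P + 3.
Proof.
move=> [f [ok dis sP]] ij si sj me ma.
have is_ : i \in domf s by rewrite -fndSome si.
have js : j \in domf s by rewrite -fndSome sj.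
have [[g1 [V1 M1 _ p1]] [g2 [V2 M2 _ p2]]] := (ok _ _ si, ok _ _ sj).
have [g3 [V3 M3 d3 p3]] := meld_amortized V1 V2 M1 M2 (dis _ _ _ _ ij si sj) me.
have [g4 [V4 M4 d4 sm4 p4]] := maintain_amortized V3 M3 ma.
have ij' : i \in domf s `\ j by rewrite !inE ij.
exists (potential h4 g4 + \sum_(k <- (domf s `\ j) `\ i) f k); last first.
  by move: sP; rewrite (big_fsetD1 j js) /= (big_fsetD1 i ij') /=; lia.
have D k hk : k != i -> k != j -> s.[? k] = Some hk -> [disjoint dom h4 & dom
  hk].
  move=> ki kj sk; apply: fdisjointWl (fsubset_trans d4 d3) _.
  by rewrite fdisjointUX (dis _ _ _ _ _ si sk) 1?eq_sym // (dis _ _ _ _ _ sj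
    sk) // eq_sym.
exists (fun k => if k == i then potential h4 g4 else f k); split.
- move=> k hk; rewrite fnd_set fnd_rem1; case: eqP => [_ [<-]|_];
    first by exists g4.
  by case: eqP => // _; exact: ok.
- move=> k l hk hl kl; rewrite !fnd_set !fnd_rem1.
  case: (eqVneq k i) => ki; case: (eqVneq l i) => li.
  + by rewrite ki li eqxx in kl.
  + by move=> [<-]; case: eqP => //= /eqP lj; exact: D.
  + by case: eqP => //= /eqP kj sk [<-]; rewrite fdisjoint_sym;
      exact: D ki kj sk.
  + by case: eqP => //= _ sk; case: eqP => //= _; exact: dis kl sk.
rewrite (_ : domf _ = domf s `\ j); last first.
  apply/fsetP => k; rewrite dom_setf domf_rem in_fset1U; case: eqP => // ->.
  by rewrite ij'.
rewrite (big_fsetD1 i ij') /= eqxx leq_add2l.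
by apply: leq_sum_fset => k; rewrite !inE => /andP[/negbTE->].
Qed.

Lemma perform_amortized k s P ev s' : (c <= (2 ^ k)%:R)%R -> state_ok s P ->
  perform kind c s ev s' ->
  exists2 P', state_ok s' P' &
    P' + ev_time ev <= P + (A + 20 + 18 * k.+1) * op_bound ev.
Proof.
move=> ck S; case=> {ev s'}.
- move=> i is_; exists P; first exact: make_heap_amortized.
  by rewrite /op_bound /=; lia.
- by move=> i h si; exists P => //; rewrite /op_bound /=; lia.
- move=> i h e key x h1 t h2 si _ fx me ma.
  have [P' S' p'] := insert_amortized S si fx me ma.
  by exists P' => //; rewrite /op_bound /=; lia.
- move=> i h e u t1 h1 t2 h2 si _ ue de ma.
  have [P' S' p'] := delete_amortized ck S si ue de ma.
  by exists P' => //; rewrite /op_bound /=; lia.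
- move=> i j h1 h2 h3 t h4 ij si sj _ me ma.
  have [P' S' p'] := meld_state_amortized S ij si sj me ma.
  by exists P' => //; rewrite /op_bound /=; lia.
- move=> i h e key u nd x t1 h1 t2 h2 si un ue _ fx de ma.
  have [P' S' p'] := decrease_amortized S si un ue fx de ma.
  by exists P' => //; rewrite /op_bound /=; lia.
move=> i h e u t1 h1 t2 h2 si ue de ma.
have [P' S' p'] := delete_amortized ck S si ue de ma.
by exists P' => //; rewrite /op_bound /=; lia.
Qed.

Lemma execution_amortized k tr s : (c <= (2 ^ k)%:R)%R -> execution kind c tr s
  ->
  exists2 P, state_ok s P & P + \sum_(ev <- tr) ev_time ev <=
    \sum_(ev <- tr) (A + 20 + 18 * k.+1) * op_bound ev.
Proof.
move=> ck; elim=> [|{}tr {}s ev s' _ [P S p] pe].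
  exists 0; last by rewrite !big_nil.
  exists (fun => 0); split; [by move=> i h;
    rewrite fnd_fmap0 | by move=> i j hi hj _; rewrite fnd_fmap0 |].
  by rewrite big_seq_fset0.
have [P' S' p'] := perform_amortized ck S pe.
by exists P' => //; rewrite !big_rcons /=; lia.
Qed.

End Rebuilding.
End Potential.
End Heaps.

Theorem theorem5p1 (R : realType) (c : R) (hc : (1 < c)%R) (kind : heap_kind) :
  exists C : nat,
    forall (disp : Order.disp_t) (Key : orderType disp) (Item : Type)
      (tr : seq (event Key Item)) (s : state Key Item),
    execution kind c tr s ->
      (\sum_(ev <- tr) ev_time ev <= \sum_(ev <- tr) C * op_bound ev)%N
      /\ forall (i : nat) (h : heap Key Item), s.[? i]%fmap = Some h ->
           (heap_space h <= C * num_items h)%N.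
Proof.
have c0 : (0 < c)%R by exact: lt_trans hc.
have [A cA] : exists A : nat, (6%:R * c <= A%:R * (c - 1))%R.
  have d0 : (0 < c - 1)%R by rewrite subr_gt0.
  exists (Num.bound (6%:R * c / (c - 1)))%R; rewrite -ler_pdivrMr //.
  exact/ltW/archi_boundP/divr_ge0/ltW/d0/mulr_ge0/ltW/c0.
have [k ck] : exists k : nat, (c <= (2 ^ k)%:R)%R.
  exists (Num.bound c); apply: le_trans (ltW (archi_boundP (ltW c0))) _.
  by rewrite ler_nat ltnW // ltn_expl.
exists (A + 20 + 18 * k.+1 + 3 * 2 ^ k) => disp Key Item tr s ex.
have [P S p] := execution_amortized hc cA ck ex; split.
  apply: (@leq_trans (P + \sum_(ev <- tr) ev_time ev)); first exact: leq_addl.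
  by apply: leq_trans p _; apply: leq_sum => ev _;
    rewrite leq_mul2r leq_addr orbT.
move=> i h si; have [f [ok _ _]] := S; have [g [V _ sm _]] := ok _ _ si.
apply: leq_trans (space_bound V) _.
have := num_nodes_le ck sm; nia.
Qed.
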